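(* Let $\varepsilon=MN^{-1}$, $c=N^{1/2}C$ and $\varrho(w)=N^{-1/2}\lambda(N^{-1/2}w)$ for $|w|\le c$. Consider the dynamic programming equation $$r_\varepsilon(s,x,t)=\min\bigl(r_{1,\varepsilon}(s,x,t),r_{2,\varepsilon}(s,x,t)\bigr),$$ where $s,t$ are nonnegative multiples of $\varepsilon$ with $s+t\le1$, $r_{1,\varepsilon}(s,x,t)=r_{2,\varepsilon}(s,x,t)=0$ for $s+t=1$, and $$r_{1,\varepsilon}(s,x,t)=\varepsilon g_1(x,t)+r_\varepsilon(s+\varepsilon,x,t),$$ $$r_{2,\varepsilon}(s,x,t)=\varepsilon g_2(x,t)+r_\varepsilon(s,x,t+\varepsilon)*f_{\varepsilon D}(x)$$ for $0\le s+t<1$. Here $$g_1(x,t)=\int_0^c w\exp\left(D^{-1}(xw-0.5\,tw^2)\right)\varrho(w)\,dw,$$ $$g_2(x,t)=\int_{-c}^0|w|\exp\left(D^{-1}(xw-0.5\,tw^2)\right)\varrho(w)\,dw.$$ Then the Bayesian risk (over strategies that process the data in batches of size $M$) is $$R^B_N(\lambda)=N^{1/2}r_\varepsilon(0,0,0).$$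
   Context: Gaussian densities: for a variance $V>0$, $f_V(x|a)=(2\pi V)^{-1/2}\exp\{-(x-a)^2/(2V)\}$ and $f_V(x)=f_V(x|0)$. Convolution is taken in the $x$ variable: $F(x)*G(x)=\int_{-\infty}^{\infty}F(x-y)G(y)\,dy$. Gaussian one-armed bandit: fix $D>0$, $0<C<\infty$ and positive integers $N,M$ with $N$ a multiple of $M$. At each step $i=1,\dots,N$ an action $y_i\in\{1,2\}$ is chosen and a random income $\xi_i$ depending only on the current action is received. If $y_i=2$, $\xi_i$ has density $f_D(x|m)$ with $D$ known and $m$ unknown; if $y_i=1$, $\xi_i$ has a known distribution with expectation $0$. The parameter is $\theta=(0,m)$, with $|m|\le C$, i.e. $|w|\le c$ for $w=N^{1/2}m$. Strategies: the history is described by $(k,X,n)$, where $k,n$ are the numbers of past applications of the first and the second action and $X$ is the cumulative income from the second action ($X=0$ if $n=0$). A strategy $\sigma$ assigns to each history a (possibly randomized) selection of the next action, and only strategies that may change the action after applying it $M$ times in succession are used: a selection is made when $k,n$ are multiples of $M$ and the selected action is used for the next $M$ steps. Scaled variables: $s=k/N$, $t=n/N$, $x=N^{-1/2}X$. Loss: $L_N(\sigma,\theta)=N\max(0,m)-\mathrm{E}_{\sigma,\theta}\bigl(\sum_{i=1}^N\xi_i\bigr)$. Prior: $\lambda$ is a probability density of $m$ on $[-C,C]$ with $\int_{-C}^0|m|\lambda(m)\,dm>0$ and $\int_0^C m\lambda(m)\,dm>0$. Bayesian risk: $R^B_N(\lambda)=\min_{\sigma}\int_{-C}^{C}L_N(\sigma,(0,m))\,\lambda(m)\,dm$.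 *)

(* Defs.v *)
From HB Require Import structures.
From mathcomp Require Import all_boot all_order all_algebra.
From mathcomp Require Import all_classical all_reals all_analysis.
From mathcomp Require Import measurable_realfun ring.

Set Implicit Arguments.
Unset Strict Implicit.
Unset Printing Implicit Defensive.

Import Order.TTheory GRing.Theory Num.Theory.
Import numFieldNormedType.Exports.

Local Open Scope classical_set_scope.
Local Open Scope ring_scope.

(* One step of the process is a pair (y, xi) : bool * R of an action and an
   income; [false] stands for the action 1 (known income distribution, mean 0)
   and [true] for the action 2 (Gaussian income, unknown mean). A history of
   length n is an n-tuple of steps, listed in chronological order. *)

Section histories.
Context {R : realType} (n : nat).
Implicit Types h : n.-tuple (bool * R).

Definition nb_first h : nat := count (fun z => ~~ z.1) h.
Definition nb_second h : nat := count (fun z => z.1) h.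
Definition cum_second h : R := \sum_(z <- h | z.1) z.2.
Definition last_action h : bool := (last (false, 0) h).1.

Let measurable_count (p : pred bool) :
  measurable_fun [set: n.-tuple (bool * R)] (fun h => count (fun z => p z.1) h).
Proof.
have -> : (fun h : n.-tuple (bool * R) => count (fun z => p z.1) h) =
    (fun h => \sum_(i <- index_enum 'I_n) p (tnth h i).1)%N.
  by apply/funext => h; rewrite -sum1_count big_mkcond big_tuple.
elim: (index_enum _) => [|i s IH].
  by under eq_fun do rewrite big_nil; exact: measurable_cst.
under eq_fun do rewrite big_cons.
apply: measurable_fun_addn => //.
apply: (@measurableT_comp _ _ _ _ _ _
  (fun z : bool * R => nat_of_bool (p z.1))).
  have mp : measurable_fun [set: bool] (fun b : bool => nat_of_bool (p b)).
    by [].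
  exact: measurableT_comp mp measurable_fst.
exact: measurable_tnth.
Qed.

Lemma measurable_nb_first : measurable_fun [set: _] nb_first.
Proof. exact: (measurable_count negb). Qed.

Lemma measurable_nb_second : measurable_fun [set: _] nb_second.
Proof. exact: (measurable_count id). Qed.

Lemma measurable_cum_second : measurable_fun [set: _] cum_second.
Proof.
rewrite /cum_second.
under eq_fun do rewrite big_mkcond big_tuple.
apply: measurable_sum => i; apply: measurable_fun_ifT => //.
  by apply: (measurableT_comp measurable_fst); exact: measurable_tnth.
by apply: (measurableT_comp measurable_snd); exact: measurable_tnth.
Qed.

End histories.

Lemma measurable_last_action {R : realType} n :
  measurable_fun [set: _] (@last_action R n).
Proof.
case: n => [|n].
  rewrite (_ : @last_action R 0 = cst false)//.
  by apply/funext => h; rewrite /last_action tuple0.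
rewrite (_ : @last_action R n.+1 = fun h => (tnth h ord_max).1).
  by apply: (measurableT_comp measurable_fst); exact: measurable_tnth.
apply/funext => h; rewrite /last_action (tnth_nth (false, 0)) /=.
by rewrite (last_nth (false, 0)) size_tuple.
Qed.

Lemma measurable_rcons {R : realType} n :
  measurable_fun [set: n.-tuple (bool * R) * (bool * R)]
    (fun u => [tuple of rcons u.1 u.2] : n.+1.-tuple (bool * R)).
Proof.
apply/measurable_fun_tnthP => i.
have [ilt|ige] := ltnP i n.
  rewrite (_ : _ \o _ = fun u => tnth u.1 (Ordinal ilt)).
    by apply: (@measurableT_comp _ _ _ _ _ _ (fun h => tnth h (Ordinal ilt)));
      first exact: measurable_tnth.
  apply/funext => u /=.
  by rewrite !(tnth_nth (false, 0)) /= nth_rcons size_tuple ilt.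
rewrite (_ : _ \o _ = snd)//.
apply/funext => u /=.
have -> : i = ord_max.
  by apply/val_inj => /=; apply/eqP; rewrite eqn_leq ige -ltnS ltn_ord.
by rewrite (tnth_nth (false, 0)) /= nth_rcons size_tuple ltnn eqxx.
Qed.

Section controlled_process.
Context {R : realType}.

(* [sigma k n X] is the law of the action selected after k uses of the action 1
   and n uses of the action 2 with cumulative income X from the latter;
   kernels are measurable in X. *)
Definition strategy := nat -> nat -> R.-pker R ~> bool.

Variables (M : nat) (sigma : strategy).
Variable inc : bool -> probability (measurableTypeR R) R.

Section selection.
Context (n : nat).

(* Law of the next action: between two selections the last action is kept. *)
Definition selection (h : n.-tuple (bool * R)) : {measure set bool -> \bar R} :=
  if (M %| nb_first h)%N && (M %| nb_second h)%N
  then sigma (nb_first h) (nb_second h) (cum_second h)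
  else \d_(last_action h).

Let selection_measurable U : measurable U ->
  measurable_fun [set: n.-tuple (bool * R)] (selection ^~ U).
Proof.
move=> mU.
pose A k l := [set h : n.-tuple (bool * R) | nb_first h = k /\ nb_second h = l].
have mA k l : measurable (A k l).
  apply: measurableI.
    rewrite -[X in measurable X]setTI.
    exact: (measurable_nb_first measurableT (Y := [set k])).
  rewrite -[X in measurable X]setTI.
  exact: (measurable_nb_second measurableT (Y := [set l])).
rewrite (_ : [set: _] = \bigcup_k \bigcup_l A k l); last first.
  apply/esym; rewrite -subTset => h _.
  by exists (nb_first h) => //; exists (nb_second h).
apply/measurable_fun_bigcup => k; first exact: bigcupT_measurable.
apply/measurable_fun_bigcup => l //.
have [kl|kl] := boolP ((M %| k)%N && (M %| l)%N).
- apply: (eq_measurable_fun (fun h => sigma k l (cum_second h) U)).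
    by move=> h; rewrite inE /selection => -[-> ->]; rewrite kl.
  apply: measurable_funTS.
  apply: (@measurableT_comp _ _ _ _ _ _ (fun x => sigma k l x U)).
    exact: measurable_kernel.
  exact: measurable_cum_second.
- apply: (eq_measurable_fun (fun h => (\d_(last_action h))%R U : \bar R)).
    by move=> h; rewrite inE /selection => -[-> ->]; rewrite (negbTE kl).
  apply: measurable_funTS.
  apply: (@measurableT_comp _ _ _ _ _ _
    (fun b : bool => (\d_b)%R U : \bar R)) => //.
  exact: measurable_last_action.
Qed.

HB.instance Definition _ :=
  isKernel.Build _ _ _ _ R selection selection_measurable.

Let selection_setT h : selection h [set: bool] = 1%E.
Proof.
rewrite /selection; case: ifP => _; first exact: prob_kernel.
by rewrite /= diracT.
Qed.

HB.instance Definition _ :=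
  Kernel_isProbability.Build _ _ _ _ R selection selection_setT.

End selection.

Section next_law.
Context (n : nat) (P : probability (n.-tuple (bool * R)) R).

Definition next_law (A : set (n.+1.-tuple (bool * R))) : \bar R :=
  (\int[P]_h \int[selection h]_a
     inc a [set x | A [tuple of rcons h (a, x)]])%E.

Let sect (A : set (n.+1.-tuple (bool * R))) (h : n.-tuple (bool * R)) a :
    set (measurableTypeR R) :=
  [set x | A [tuple of rcons h (a, x)]].

Let measurable_sect A h a : measurable A -> measurable (sect A h a).
Proof.
move=> mA.
have mf : measurable_fun [set: R]
    (fun x => [tuple of rcons h (a, x)] : n.+1.-tuple (bool * R)).
  have mg : measurable_fun [set: R] (fun x : R => (h, (a, x))).
    apply/measurable_fun_pair; first exact: measurable_cst.
    by apply/measurable_fun_pair; [exact: measurable_cst|exact: measurable_id].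
  exact: (measurableT_comp (@measurable_rcons R n) mg).
by rewrite -[X in measurable X]setTI; exact: mf.
Qed.

Let measurable_inc_sect A : measurable A ->
  measurable_fun [set: n.-tuple (bool * R) * bool]
    (fun u => inc u.2 (sect A u.1 u.2)).
Proof.
move=> mA.
have mf a :
    measurable_fun [set: n.-tuple (bool * R)] (fun h => inc a (sect A h a)).
  pose B : set (n.-tuple (bool * R) * measurableTypeR R) :=
    [set u : n.-tuple (bool * R) * R | A [tuple of rcons u.1 (a, u.2)]].
  have mB : measurable B.
    have mg : measurable_fun [set: n.-tuple (bool * R) * measurableTypeR R]
      (fun u : n.-tuple (bool * R) * R =>
         [tuple of rcons u.1 (a, u.2)] : n.+1.-tuple (bool * R)).
      have mk : measurable_fun [set: n.-tuple (bool * R) * measurableTypeR R]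
          (fun u : n.-tuple (bool * R) * R => (u.1, (a, u.2))).
        apply/measurable_fun_pair; first exact: measurable_fst.
        apply/measurable_fun_pair; first exact: measurable_cst.
        exact: measurable_snd.
      exact: (measurableT_comp (@measurable_rcons R n) mk).
    by rewrite -[X in measurable X]setTI; exact: mg.
  rewrite (_ : (fun _ => _) = inc a \o xsection B).
    exact: measurable_fun_xsection.
  by apply/funext => h /=; congr (inc a _); rewrite xsectionE.
rewrite (_ : (fun _ => _) = fun u => if u.2 then inc true (sect A u.1 true)
   else inc false (sect A u.1 false)).
  exact: (measurable_fun_if_pair (mf true) (mf false)).
by apply/funext => -[h []].
Qed.

Let measurable_step A : measurable A ->
  measurable_fun [set: n.-tuple (bool * R)]
    (fun h => \int[selection h]_a inc a (sect A h a))%E.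
Proof.
move=> mA.
have := @measurable_fun_integral_finite_kernel _ _ _ _ _
   (fun u => inc u.2 (sect A u.1 u.2)) (@selection n) (fun=> measure_ge0 _ _).
by move/(_ (measurable_inc_sect mA)).
Qed.

Let next0 : next_law set0 = 0%E.
Proof.
apply: integral0_eq => h _; apply: integral0_eq => a _.
by rewrite (_ : [set _ | _] = set0) ?measure0.
Qed.

Let next_ge0 A : (0 <= next_law A)%E.
Proof. by apply: integral_ge0 => h _; apply: integral_ge0. Qed.

Let next_sigma_additive : semi_sigma_additive next_law.
Proof.
move=> F mF tF mUF; apply: cvg_toP.
  by apply: is_cvg_ereal_nneg_natsum_cond => k _ _; exact: next_ge0.
rewrite /next_law -integral_nneseries//; last 2 first.
- by move=> k; exact: measurable_step.
- by move=> k h _; exact: integral_ge0.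
apply: eq_integral => h _; rewrite -integral_nneseries//.
apply: eq_integral => a _.
have -> : [set x | (\bigcup_k F k) [tuple of rcons h (a, x)]] =
  \bigcup_k sect (F k) h a by [].
rewrite measure_bigcup//.
- by apply: eq_eseriesl => k; rewrite in_setT.
- by move=> k _; exact: measurable_sect.
- move=> i j _ _ [x [Fi Fj]].
  by apply: tF => //; exists [tuple of rcons h (a, x)].
Qed.

HB.instance Definition _ := isMeasure.Build _ _ _ next_law
  next0 next_ge0 next_sigma_additive.

Let next_setT : next_law [set: _] = 1%E.
Proof.
have e h : (\int[selection h]_a inc a (sect setT h a) = 1)%E.
  rewrite (eq_integral (cst 1%E)).
    by rewrite integral_cst// mul1e prob_kernel.
  by move=> a _; rewrite /sect -[RHS](probability_setT (inc a)).
rewrite /next_law (eq_integral (cst 1%E)).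
  by rewrite integral_cst// mul1e; exact: probability_setT.
by move=> h _; exact: e.
Qed.

HB.instance Definition _ :=
  @Measure_isProbability.Build _ _ R next_law next_setT.

End next_law.

(* Law of the first n steps, [inc a] being the income law of the action a. *)
Fixpoint law n : probability (n.-tuple (bool * R)) R :=
  if n is n'.+1 then next_law (law n') else \d_[tuple].

End controlled_process.

Section bandit.
Context {R : realType} (D : R) (N M : nat).
Variable mu1 : probability (measurableTypeR R) R.

Definition income (m : R) (a : bool) : probability (measurableTypeR R) R :=
  if a then (normal_prob m (Num.sqrt D) : probability (measurableTypeR R) R)
  else mu1.

Definition loss (sigma : strategy) (m : R) : R :=
  N%:R * Num.max 0 m -
  fine 'E_(law M sigma (income m) N)[fun w => \sum_(i < N) (tnth w i).2].

Definition bayes_loss (C : R) (lambda : R -> R) (sigma : strategy) : R :=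
  \int[lebesgue_measure]_(m in `[- C, C]) (loss sigma m * lambda m).

(* The Bayesian risk is a minimum: it is attained by some strategy. *)
Definition is_bayes_risk (C : R) (lambda : R -> R) (v : R) : Prop :=
  (exists sigma, bayes_loss C lambda sigma = v) /\
  (forall sigma, v <= bayes_loss C lambda sigma).

End bandit.

Section dynamic_programming.
Context {R : realType}.
Local Notation mu := (@lebesgue_measure R).

(* [normal_pdf] takes the standard deviation, V is the variance. *)
Definition gauss (V a x : R) : R := normal_pdf a (Num.sqrt V) x.

Definition conv (F G : R -> R) (x : R) : R := \int[mu]_y (F (x - y) * G y).

Definition g1 (D c : R) (rho : R -> R) (x t : R) : R :=
  \int[mu]_(w in `[0, c])
    (w * expR (D^-1 * (x * w - 2^-1 * t * w ^+ 2)) * rho w).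

Definition g2 (D c : R) (rho : R -> R) (x t : R) : R :=
  \int[mu]_(w in `[- c, 0])
    (`|w| * expR (D^-1 * (x * w - 2^-1 * t * w ^+ 2)) * rho w).

Definition dp_equation (D eps : R) (G1 G2 : R -> R -> R)
    (r r1 r2 : R -> R -> R -> R) : Prop :=
  forall (i j : nat) (x : R), let s := i%:R * eps in let t := j%:R * eps in
  s + t <= 1 ->
  [/\ r s x t = Num.min (r1 s x t) (r2 s x t),
      s + t = 1 -> r1 s x t = 0 /\ r2 s x t = 0 &
      s + t < 1 ->
        r1 s x t = eps * G1 x t + r (s + eps) x t /\
        r2 s x t = eps * G2 x t +
          conv (fun x' => r s x' (t + eps)) (gauss (eps * D) 0) x].

(* The equation always has a solution, by recursion on the number of
   remaining batches. *)
Lemma dp_equation_solvable (D : R) (K : nat) (G1 G2 : R -> R -> R) :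
  (0 < K)%N -> exists r r1 r2, dp_equation D K%:R^-1 G1 G2 r r1 r2.
Proof.
move=> K0; set eps : R := K%:R^-1.
have K0' : K%:R != 0 :> R by rewrite pnatr_eq0 -lt0n.
pose V1 (V : R -> nat -> R) (x : R) (j : nat) :=
  eps * G1 x (j%:R * eps) + V x j.
pose V2 (V : R -> nat -> R) (x : R) (j : nat) := eps * G2 x (j%:R * eps) +
  conv (fun x' => V x' j.+1) (gauss (eps * D) 0) x.
pose fix V (k : nat) (x : R) (j : nat) {struct k} : R := if k is k'.+1 then
  Num.min (V1 (V k') x j) (V2 (V k') x j) else 0.
pose left (s t : R) := Num.truncn (K%:R * (1 - s - t)).
pose step (W : (R -> nat -> R) -> R -> nat -> R) (s x t : R) :=
  if left s t is k.+1 then W (V k) x (Num.truncn (K%:R * t)) else 0.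
have tE (j : nat) : Num.truncn (K%:R * (j%:R * eps) : R) = j.
  by rewrite mulrCA divff// mulr1 natrK.
have leftE (i j : nat) : (i + j <= K)%N ->
    left (i%:R * eps) (j%:R * eps) = (K - (i + j))%N.
  move=> ijK; rewrite /left -[RHS](@natrK R); congr Num.truncn.
  by rewrite natrB// natrD /eps; field.
have sumE (i j : nat) : (i%:R * eps + j%:R * eps : R) = (i + j)%:R / K%:R.
  by rewrite -mulrDl natrD.
exists (fun s x t => V (left s t) x (Num.truncn (K%:R * t))).
exists (step V1), (step V2).
move=> i j x s t; rewrite /s /t sumE.
have KP : 0 < K%:R :> R by rewrite ltr0n.
rewrite ler_pdivrMr// mul1r ler_nat => ijK; split.
- by rewrite /step leftE// tE; case: (K - _)%N => //=; rewrite minxx.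
- move=> /(congr1 ( *%R^~ K%:R)); rewrite /= divfK// mul1r => /eqP.
  by rewrite eqr_nat => /eqP ijE; rewrite /step leftE// ijE subnn.
- rewrite ltr_pdivrMr// mul1r ltr_nat => ijlt.
  have E1 : i%:R * eps + eps = i.+1%:R * eps by rewrite -natr1 mulrDl mul1r.
  have E2 : j%:R * eps + eps = j.+1%:R * eps by rewrite -natr1 mulrDl mul1r.
  have e1 : (K - (i + j))%N = (K - (i + j).+1).+1 by rewrite subnSK.
  rewrite /step E1 E2 !leftE ?addSn ?addnS// !tE e1.
  by [].
Qed.

End dynamic_programming.

(* Main.v *)
From HB Require Import structures.
Require Import Defs.
From mathcomp Require Import all_boot all_order all_algebra.
From mathcomp Require Import all_classical all_reals all_analysis.
From mathcomp Require Import measurable_realfun ring.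

(* Under the reference measure m = 0, the law of the history for the mean m has
   the density exp (D^-1 (X m - n m^2 / 2)), where n is the number of uses of
   the action 2 and X their cumulative income. Since the loss is the expectation
   of (number of uses of 1) * m^+ + (number of uses of 2) * m^-, Tonelli's
   theorem turns the Bayesian loss into the expectation, under the reference
   measure alone, of a terminal cost depending only on the two numbers of uses
   and on X. Minimizing such an expectation is solved by backward induction on
   single steps. Along a batch the induction telescopes: integrated against the
   unnormalized posterior, the regret is a martingale of X under Gaussian
   increments, and M increments of variance D add up to one of variance M D.
   Subtracting the regret already paid leaves the dynamic programming equation,
   up to the scaling of X and m by sqrt N. *)

Set Implicit Arguments.
Unset Strict Implicit.
Unset Printing Implicit Defensive.

Import Order.TTheory GRing.Theory Num.Theory.
Import numFieldNormedType.Exports.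

Local Open Scope classical_set_scope.
Local Open Scope ring_scope.

(** * Lebesgue measure and normal laws *)

(** Wherever possible the integrands are nonnegative and extended-real, so that Tonelli's theorem
    and the changes of measure need no integrability; signed incomes occur only where the loss is
    identified with a regret. The obstacle is that the losses and the dynamic programming equation
    are real: their integrals are read through [fine], which sends an infinite integral to 0.
    Finiteness must be known before the two kinds of integrals can be identified; for the posterior
    quantities it comes from the bounded support of the prior. Nor does the equation say that its
    solution is measurable, so this regularity is produced by the same backward induction that
    identifies the solution with the value function. The single-step value function carries the last
    action as an additional state, because inside a batch that action imposes the next one. The
    minimum is attained because comparing the costs of the two actions is a measurable deterministic
    selection. *)

Section change_of_variables.
Context {R : realType}.
Local Notation mu := (@lebesgue_measure R).

Lemma ge0_integral_normal_prob (m s : R) (f : R -> \bar R) :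
  measurable_fun [set: measurableTypeR R] f -> (forall x, 0 <= f x)%E ->
  (\int[normal_prob m s]_x f x = \int[mu]_x (f x * (normal_pdf m s x)%:E))%E.
Proof.
move=> mf f0; have dom := @normal_prob_dominates R m s.
rewrite -(Radon_Nikodym_SigmaFinite.change_of_variables dom f0)//.
have mg : measurable_fun [set: measurableTypeR R] (EFin \o normal_pdf m s).
  by apply/measurable_EFinP; exact: measurable_normal_pdf.
have mh : measurable_fun [set: measurableTypeR R]
    (Radon_Nikodym_SigmaFinite.f (normal_prob m s) mu).
  exact: measurable_int (Radon_Nikodym_SigmaFinite.f_integrable dom).
apply: ae_eq_integral => //.
- exact: emeasurable_funM.
- exact: emeasurable_funM.
(* The Radon-Nikodym derivative and the pdf have the same integral over every measurable set, hence
   agree almost everywhere. *)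
- apply: ae_eqe_mul2l; apply: integral_ae_eq => //.
  + exact: Radon_Nikodym_SigmaFinite.f_integrable.
  + by move=> A _ mA; rewrite -Radon_Nikodym_SigmaFinite.f_integral.
Qed.

(** The left-hand side is a measure in [A], a scaled pushforward, so by uniqueness of the Lebesgue
    measure it suffices to compare lengths of half-open intervals. *)
Lemma lebesgue_measure_affine (k a : R) (A : set R) : 0 < k -> measurable A ->
  (k%:E * mu ((fun x => (k * x + a)%R) @^-1` A) = mu A)%E.
Proof.
move=> k0 mA.
pose phi : measurableTypeR R -> measurableTypeR R := fun x => k * x + a.
have mphi : measurable_fun [set: measurableTypeR R] phi.
  by apply: measurable_funD => //; exact: measurable_funM.
have [nu nuE] : exists nu : {measure set (measurableTypeR R) -> \bar R},
    forall B, nu B = (k%:E * mu (phi @^-1` B))%E.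
  by unshelve eexists (mscale (NngNum (ltW k0)) (pushforward mu phi)).
rewrite -nuE; apply/esym/lebesgue_measure_unique => //= _ [[u v]] _ <- /=.
rewrite nuE.
have -> : phi @^-1` `]u, v] = `](u - a) / k, (v - a) / k]%classic.
  apply/seteqP; split => x /=; rewrite !in_itv/= /phi.
    by rewrite ltr_pdivrMr// ler_pdivlMr// mulrC ltrBlDr lerBrDr.
  by rewrite ltr_pdivrMr// ler_pdivlMr// mulrC ltrBlDr lerBrDr.
rewrite !lebesgue_measure_itv/= !lte_fin ltr_pM2r ?invr_gt0// ltrD2r.
case: ifP => _; last by rewrite mule0.
by rewrite -!EFinD -EFinM; congr EFin; field; rewrite gt_eqF.
Qed.

Lemma ge0_integral_affine (k a : R) (f : R -> \bar R) : 0 < k ->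
  measurable_fun [set: measurableTypeR R] f -> (forall x, 0 <= f x)%E ->
  (\int[mu]_x f x = k%:E * \int[mu]_x f (k * x + a)%R)%E.
Proof.
move=> k0 mf f0.
pose phi : measurableTypeR R -> measurableTypeR R := fun x => k * x + a.
have mphi : measurable_fun [set: measurableTypeR R] phi.
  by apply: measurable_funD => //; exact: measurable_funM.
have := ge0_integral_pushforward mphi mu measurableT mf (fun x _ => f0 x).
rewrite preimage_setT /= => <-.
rewrite -(@ge0_integral_mscale _ _ _ _ _ measurableT (NngNum (ltW k0)))//=.
apply: eq_measure_integral => A mA _.
by rewrite /mscale/= -(lebesgue_measure_affine a k0 mA).
Qed.

Lemma ge0_integral_oppr (f : R -> \bar R) :
  measurable_fun [set: measurableTypeR R] f -> (forall x, 0 <= f x)%E ->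
  (\int[mu]_x f (- x)%R = \int[mu]_x f x)%E.
Proof.
move=> mf f0.
have mphi : measurable_fun [set: measurableTypeR R]
    (-%R : measurableTypeR R -> measurableTypeR R) by [].
have := ge0_integral_pushforward mphi mu measurableT mf (fun x _ => f0 x).
rewrite preimage_setT /= => <-.
by apply: eq_measure_integral => A mA _; rewrite -[RHS]lebesgue_measureN.
Qed.

Lemma ge0_integral_translation (a : R) (f : R -> \bar R) :
  measurable_fun [set: measurableTypeR R] f -> (forall x, 0 <= f x)%E ->
  (\int[mu]_x f (x + a)%R = \int[mu]_x f x)%E.
Proof.
move=> mf f0; rewrite [RHS](@ge0_integral_affine 1 a)// mul1e.
by under [RHS]eq_integral do rewrite mul1r.
Qed.

End change_of_variables.

(** * The law of the histories *)

Section integral_law.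
Context {R : realType} (M : nat) (sigma : @strategy R).
Variable inc : bool -> probability (measurableTypeR R) R.

Let income_kernel : bool -> {measure set (measurableTypeR R) -> \bar R} := inc.

Let measurable_income_kernel U : measurable U ->
  measurable_fun [set: bool] (income_kernel ^~ U).
Proof. by []. Qed.

HB.instance Definition _ := @isKernel.Build _ _ bool (measurableTypeR R) R
  income_kernel measurable_income_kernel.

HB.instance Definition _ := @Kernel_isProbability.Build _ _ bool
  (measurableTypeR R) R income_kernel (fun a => probability_setT (inc a)).

(* [next_law] is a composition of kernels of the library, for which
   [integral_kcomp] computes the integrals of nonnegative functions. *)
Lemma ge0_integral_next_law n (P : probability (n.-tuple (bool * R)) R)
    (f : n.+1.-tuple (bool * R) -> \bar R) :
  measurable_fun [set: _] f -> (forall h, 0 <= f h)%E ->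
  (\int[next_law M sigma inc P]_h f h =
   \int[P]_h \int[selection M sigma h]_a
     \int[inc a]_x f [tuple of rcons h (a, x)])%E.
Proof.
move=> mf f0.
have mcons : measurable_fun
    [set: (unit * n.-tuple (bool * R) * bool) * measurableTypeR R]
    (fun u : (unit * n.-tuple (bool * R) * bool) * measurableTypeR R =>
       [tuple of rcons u.1.1.2 (u.1.2, u.2)]).
  have mg : measurable_fun
      [set: (unit * n.-tuple (bool * R) * bool) * measurableTypeR R]
      (fun u : (unit * n.-tuple (bool * R) * bool) * R =>
         (u.1.1.2, (u.1.2, u.2))).
    apply/measurable_fun_pair => /=.
      apply: (measurableT_comp measurable_snd).
      exact: (measurableT_comp measurable_fst).
    apply/measurable_fun_pair => /=; last exact: measurable_snd.
    exact: (measurableT_comp measurable_snd).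
  exact: (measurableT_comp (@measurable_rcons R n) mg).
(* [kcomp] composes a kernel with one that depends on both its source and its value. Hence the
   source [unit], which turns [P] into a kernel, the projections [kernel_snd], and the final
   deterministic kernel [d] appending the step. *)
have mP : measurable_fun [set: unit] (fun=> P : pprobability _ R) by [].
pose l := kprobability mP.
pose s : R.-sfker (unit * n.-tuple (bool * R)) ~> bool :=
  kernel.kernel_snd (@selection R M sigma n).
pose i : R.-sfker (unit * n.-tuple (bool * R)) * bool ~> measurableTypeR R :=
  kernel.kernel_snd income_kernel.
pose d : R.-sfker (unit * n.-tuple (bool * R) * bool) * measurableTypeR R ~>
  n.+1.-tuple (bool * R) := kdirac mcons.
pose ki : R.-sfker (unit * n.-tuple (bool * R)) * bool ~>
  n.+1.-tuple (bool * R) := mkcomp i d.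
pose ks : R.-sfker unit * n.-tuple (bool * R) ~>
  n.+1.-tuple (bool * R) := mkcomp s ki.
transitivity (\int[kcomp l ks tt]_h f h)%E.
  apply: eq_measure_integral => A mA _.
  apply: eq_integral => h _; apply: eq_integral => a _.
  have mh : measurable_fun [set: measurableTypeR R]
      (fun x : measurableTypeR R => [tuple of rcons h (a, x)]).
    exact: (measurableT_comp mcons (measurable_pair1 (tt, h, a))).
  rewrite -[in LHS](setIT [set x | _]) -integral_indic//.
    by rewrite -[X in measurable X]setTI; exact: mh.
rewrite integral_kcomp//; apply: eq_integral => h _.
rewrite [LHS]integral_kcomp//; apply: eq_integral => a _.
rewrite [LHS]integral_kcomp//; apply: eq_integral => x _.
by rewrite integral_dirac// diracT mul1e.
Qed.

Lemma measurable_rcons_income n (h : n.-tuple (bool * R)) a :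
  measurable_fun [set: measurableTypeR R]
    (fun x : measurableTypeR R => [tuple of rcons h (a, x)]).
Proof.
have mg : measurable_fun [set: measurableTypeR R]
    (fun x : measurableTypeR R => (h, (a, x : R))).
  by apply/measurable_fun_pair => //; exact/measurable_fun_pair.
exact: (measurableT_comp (@measurable_rcons R n) mg).
Qed.

Lemma measurable_integral_step n (f : n.+1.-tuple (bool * R) -> \bar R) :
  measurable_fun [set: _] f -> (forall h, 0 <= f h)%E ->
  measurable_fun [set: n.-tuple (bool * R)]
    (fun h => \int[selection M sigma h]_a
      \int[inc a]_x f [tuple of rcons h (a, x)])%E.
Proof.
move=> mf f0.
have mcons : measurable_fun
    [set: (n.-tuple (bool * R) * bool) * measurableTypeR R]
    (fun u : (n.-tuple (bool * R) * bool) * measurableTypeR R =>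
       f [tuple of rcons u.1.1 (u.1.2, u.2)]).
  have mg : measurable_fun
      [set: (n.-tuple (bool * R) * bool) * measurableTypeR R]
      (fun u : (n.-tuple (bool * R) * bool) * measurableTypeR R =>
         (u.1.1, (u.1.2, u.2 : R))).
    apply/measurable_fun_pair => /=.
      exact: (measurableT_comp measurable_fst).
    apply/measurable_fun_pair => /=; last exact: measurable_snd.
    exact: (measurableT_comp measurable_snd).
  exact: (measurableT_comp mf (measurableT_comp (@measurable_rcons R n) mg)).
have minc := measurable_fun_integral_finite_kernel _
  (kernel.kernel_snd income_kernel) (fun=> f0 _) mcons.
apply: (measurable_fun_integral_finite_kernel _ (@selection R M sigma n) _
  minc).
by move=> u; exact: integral_ge0.
Qed.

End integral_law.

Section likelihood_ratio.
Context {R : realType}.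
Implicit Types D m X n : R.

(* Likelihood ratio of the means m and 0 for n observations of variance D and
   sum X. *)
Definition lratio D m X n : R :=
  expR (D^-1 * (X * m - 2^-1 * n * m ^+ 2)).

Lemma lratio_ge0 D m X n : 0 <= lratio D m X n.
Proof. exact: expR_ge0. Qed.

Lemma lratio0 D m : lratio D m 0 0 = 1.
Proof. by rewrite /lratio mulr0 !mul0r subr0 mulr0 expR0. Qed.

(** The exponent is linear in the pair (sum, number of observations). *)
Lemma lratioD D m X Y n p :
  lratio D m (X + Y) (n + p) = lratio D m X n * lratio D m Y p.
Proof. by rewrite /lratio -expRD; congr expR; ring. Qed.

Lemma measurable_lratio d (T : measurableType d) D (m X n : T -> R) :
  measurable_fun [set: T] m -> measurable_fun [set: T] X ->
  measurable_fun [set: T] n ->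
  measurable_fun [set: T] (fun t => lratio D (m t) (X t) (n t)).
Proof.
move=> mm mX mn; apply: measurableT_comp => //.
apply: measurable_funM => //; apply: measurable_funB.
  exact: measurable_funM.
by apply: measurable_funM; [exact: measurable_funM|exact: measurable_funX].
Qed.

(** A sum of n observations has mean [n * m] and variance [n * D]; expanding the square
    [(x - n * m) ^+ 2] leaves exactly the exponent of [lratio]. *)
Lemma normal_pdf_lratio D m n x : 0 < D -> 0 < n ->
  normal_pdf (n * m) (Num.sqrt (n * D)) x =
  normal_pdf 0 (Num.sqrt (n * D)) x * lratio D m x n.
Proof.
move=> D0 n0; have nD : 0 < n * D by exact: mulr_gt0.
rewrite !normal_pdfE ?gt_eqF ?sqrtr_gt0// -mulrA; congr (_ * _).
rewrite /normal_fun /lratio -expRD sqr_sqrtr ?ltW//; congr expR.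
by field; rewrite !gt_eqF.
Qed.

Lemma ge0_integral_normal_lratio D m (f : R -> \bar R) : 0 < D ->
  measurable_fun [set: measurableTypeR R] f -> (forall x, 0 <= f x)%E ->
  (\int[normal_prob m (Num.sqrt D)]_x f x =
   \int[normal_prob 0 (Num.sqrt D)]_x (f x * (lratio D m x 1)%:E))%E.
Proof.
move=> D0 mf f0.
have mg : measurable_fun [set: measurableTypeR R]
    (fun x => f x * (lratio D m x 1)%:E)%E.
  apply: emeasurable_funM => //; apply/measurable_EFinP.
  exact: measurable_lratio.
have g0 x : (0 <= f x * (lratio D m x 1)%:E)%E.
  by rewrite mule_ge0// lee_fin lratio_ge0.
rewrite (ge0_integral_normal_prob m (Num.sqrt D) mf f0).
rewrite (ge0_integral_normal_prob 0 (Num.sqrt D) mg g0).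
apply: eq_integral => x _; rewrite -muleA -EFinM mulrC.
by have := normal_pdf_lratio m x D0 ltr01; rewrite !mul1r => ->.
Qed.

(** Multiplied by the centered density, the likelihood ratio becomes the density of mean [n * m], of
    mass 1. Every martingale property below goes back to this one. *)
Lemma integral_normal_lratio D m n : 0 < D -> 0 < n ->
  (\int[normal_prob 0 (Num.sqrt (n * D))]_x (lratio D m x n)%:E = 1)%E.
Proof.
move=> D0 n0; rewrite ge0_integral_normal_prob.
- rewrite -(@integral_normal_pdf R (n * m) (Num.sqrt (n * D))).
  by apply: eq_integral => x _; rewrite -EFinM mulrC -normal_pdf_lratio.
- exact/measurable_EFinP/measurable_lratio.
- by move=> x; rewrite lee_fin lratio_ge0.
Qed.

End likelihood_ratio.

Section histories.
Context {R : realType} (n : nat).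
Implicit Types (h : n.-tuple (bool * R)) (z : bool * R).

Lemma nb_first_rcons h z :
  nb_first [tuple of rcons h z] = (nb_first h + ~~ z.1)%N.
Proof. by rewrite /nb_first /= -cats1 count_cat /= addn0. Qed.

Lemma nb_second_rcons h z :
  nb_second [tuple of rcons h z] = (nb_second h + z.1)%N.
Proof. by rewrite /nb_second /= -cats1 count_cat /= addn0. Qed.

Lemma cum_second_rcons h z :
  cum_second [tuple of rcons h z] = cum_second h + (if z.1 then z.2 else 0).
Proof.
rewrite /cum_second /= -cats1 big_cat /= big_cons big_nil.
by case: z.1; rewrite ?addr0.
Qed.

Lemma last_action_rcons h z : last_action [tuple of rcons h z] = z.1.
Proof. by rewrite /last_action last_rcons. Qed.

Lemma nb_firstDsecond h : (nb_first h + nb_second h)%N = n.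
Proof.
by rewrite -[RHS](size_tuple h) -(count_predC (fun z => z.1)) addnC.
Qed.

Lemma measurable_nb_secondR :
  measurable_fun [set: _] (fun h => (nb_second h)%:R : R).
Proof.
apply: (measurableT_comp (f := fun k : nat => k%:R : R)) => //.
exact: measurable_nb_second.
Qed.

Lemma measurable_nb_firstR :
  measurable_fun [set: _] (fun h => (nb_first h)%:R : R).
Proof.
apply: (measurableT_comp (f := fun k : nat => k%:R : R)) => //.
exact: measurable_nb_first.
Qed.

End histories.

Section change_of_measure.
Context {R : realType} (D : R) (M : nat).
Variables (mu1 : probability (measurableTypeR R) R) (sigma : @strategy R).
Hypothesis D0 : 0 < D.

(** Neither the selection nor the income of the action 1 depends on [m], so only a use of the action
    2 contributes a factor, and factors multiply by [lratioD]. The induction hypothesis is applied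
    to the one-step expectation of [f], whence the generality in [f]. *)
Lemma ge0_integral_law_lratio m n (f : n.-tuple (bool * R) -> \bar R) :
  measurable_fun [set: _] f -> (forall h, 0 <= f h)%E ->
  (\int[law M sigma (income D mu1 m) n]_h f h =
   \int[law M sigma (income D mu1 0) n]_h
     (f h * (lratio D m (cum_second h) (nb_second h)%:R)%:E))%E.
Proof.
have mlr k : measurable_fun [set: k.-tuple (bool * R)]
    (fun h => (lratio D m (cum_second h) (nb_second h)%:R)%:E).
  apply/measurable_EFinP/measurable_lratio => //.
    exact: measurable_cum_second.
  exact: measurable_nb_secondR.
elim: n f => [|n IH] f mf f0.
  apply: eq_integral => h _; rewrite (tuple0 h) /cum_second /nb_second /=.
  by rewrite big_nil lratio0 mule1.
rewrite [LHS]ge0_integral_next_law// IH; last 2 first.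
  exact: measurable_integral_step.
  by move=> h; apply: integral_ge0 => a _; exact: integral_ge0.
rewrite [RHS]ge0_integral_next_law//; last 2 first.
  by apply: emeasurable_funM => //; exact: mlr.
  by move=> h; rewrite mule_ge0// lee_fin lratio_ge0.
apply: eq_integral => h _.
rewrite -ge0_integralZr//; last 2 first.
  by move=> a _; exact: integral_ge0.
  by rewrite lee_fin lratio_ge0.
apply: eq_integral => a _.
have mr : measurable_fun [set: measurableTypeR R]
    (fun x : measurableTypeR R => f [tuple of rcons h (a, x)]).
  exact: (measurableT_comp mf (measurable_rcons_income h a)).
rewrite -(ge0_integralZr _ measurableT mr); last 2 first.
  by move=> x _; exact: f0.
  by rewrite lee_fin lratio_ge0.
case: a mr => mr /=.
- have mg : measurable_fun [set: measurableTypeR R]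
      (fun x => f [tuple of rcons h (true, x)] *
        (lratio D m (cum_second h) (nb_second h)%:R)%:E)%E.
    by apply: emeasurable_funM => //; exact: measurable_cst.
  have g0 x : (0 <= f [tuple of rcons h (true, x)]
      * (lratio D m (cum_second h) (nb_second h)%:R)%:E)%E.
    by rewrite mule_ge0// lee_fin lratio_ge0.
  rewrite (ge0_integral_normal_lratio m D0 mg g0).
  apply: eq_integral => x _; rewrite cum_second_rcons nb_second_rcons/= addn1.
  by rewrite -natr1 lratioD EFinM -muleA.
- apply: eq_integral => x _; rewrite cum_second_rcons nb_second_rcons/=.
  by rewrite addr0 addn0.
Qed.

End change_of_measure.

(** * The loss as an expected regret *)

Section mean_income.
Context {R : realType}.

(** The law of a history is unfolded on nonnegative functions only; a signed function has to be
    treated through its two parts. *)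
Lemma funepos_neg_centered d (T : measurableType d)
    (P : {measure set T -> \bar R}) (f : T -> R) :
  measurable_fun [set: T] f ->
  (\int[P]_x ((EFin \o f)^\+ x) = \int[P]_x ((EFin \o f)^\- x))%E ->
  (\int[P]_x ((EFin \o f)^\+ x) < +oo)%E ->
  P.-integrable [set: T] (EFin \o f) /\ (\int[P]_x (f x)%:E = 0)%E.
Proof.
move=> mf e lty; have mE : measurable_fun [set: T] (EFin \o f).
  exact/measurable_EFinP.
split; last first.
  rewrite [LHS]integralE -e subee// ge0_fin_numE//.
  exact: integral_ge0.
apply/integrableP; split => //.
rewrite [ltLHS](_ : _ = \int[P]_x ((EFin \o f)^\+ x + (EFin \o f)^\- x))%E.
  rewrite ge0_integralD//; last 2 first.
    exact: measurable_funepos.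
    exact: measurable_funeneg.
  by rewrite -e lte_add_pinfty.
by apply: eq_integral => x _; rewrite -/((abse \o (EFin \o f)) x) fune_abse.
Qed.

Lemma integral_normal_centered (m s : R) (f : R -> \bar R) : s != 0 ->
  measurable_fun [set: measurableTypeR R] f -> (forall x, 0 <= f x)%E ->
  (\int[normal_prob m s]_x f (x - m)%R = \int[normal_prob 0 s]_x f x)%E.
Proof.
move=> s0 mf f0.
have mfm : measurable_fun [set: measurableTypeR R] (fun x => f (x - m)%R).
  by apply: measurableT_comp => //; exact: measurable_funB.
have mg : measurable_fun [set: measurableTypeR R]
    (fun x => f (x - m)%R * (normal_pdf m s x)%:E)%E.
  apply: emeasurable_funM => //.
  by apply/measurable_EFinP; exact: measurable_normal_pdf.
have g0 x : (0 <= f (x - m)%R * (normal_pdf m s x)%:E)%E.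
  by rewrite mule_ge0// lee_fin normal_pdf_ge0.
rewrite (ge0_integral_normal_prob m s mfm (fun x => f0 _)).
rewrite (ge0_integral_normal_prob 0 s mf f0).
rewrite -[LHS](ge0_integral_translation m mg g0).
apply: eq_integral => x _; rewrite addrK; congr (_ * _%:E)%E.
by rewrite !normal_pdfE// /normal_fun addrK subr0.
Qed.

Lemma integral_normal_oppr (s : R) (f : R -> \bar R) : s != 0 ->
  measurable_fun [set: measurableTypeR R] f -> (forall x, 0 <= f x)%E ->
  (\int[normal_prob 0 s]_x f (- x)%R = \int[normal_prob 0 s]_x f x)%E.
Proof.
move=> s0 mf f0.
have mfm : measurable_fun [set: measurableTypeR R] (fun x => f (- x)%R).
  exact: measurableT_comp.
have mg : measurable_fun [set: measurableTypeR R]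
    (fun x => f x * (normal_pdf 0 s x)%:E)%E.
  apply: emeasurable_funM => //.
  by apply/measurable_EFinP; exact: measurable_normal_pdf.
have g0 x : (0 <= f x * (normal_pdf 0 s x)%:E)%E.
  by rewrite mule_ge0// lee_fin normal_pdf_ge0.
rewrite (ge0_integral_normal_prob 0 s mfm (fun x => f0 _)).
rewrite (ge0_integral_normal_prob 0 s mf f0).
rewrite -[RHS](ge0_integral_oppr mg g0).
apply: eq_integral => x _; congr (_ * _%:E)%E.
by rewrite !normal_pdfE// /normal_fun !subr0 sqrrN.
Qed.

Variables (D m : R) (mu1 : probability (measurableTypeR R) R).
Hypotheses (D0 : 0 < D)
  (imu1 : mu1.-integrable [set: R] (fun x : R => x%:E))
  (mean_mu1 : (\int[mu1]_x x%:E = 0)%E).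

(** Income minus its conditional mean given the action, that is, a martingale increment under the
    mean [m]. *)
Definition deviation (z : bool * R) : R := z.2 - (if z.1 then m else 0).

Let sqrtD_neq0 : Num.sqrt D != 0.
Proof. by rewrite gt_eqF// sqrtr_gt0. Qed.

Let mpos : measurable_fun [set: measurableTypeR R] (EFin^\+)%E.
Proof. exact: measurable_funepos. Qed.

Let mneg : measurable_fun [set: measurableTypeR R] (EFin^\-)%E.
Proof. exact: measurable_funeneg. Qed.

Let normal_pos :
  (\int[normal_prob m (Num.sqrt D)]_x ((fun x => (x - m)%:E)^\+ x) =
   \int[normal_prob 0 (Num.sqrt D)]_x (EFin^\+ x))%E.
Proof.
rewrite -(integral_normal_centered m sqrtD_neq0 mpos (funepos_ge0 _)).
by apply: eq_integral => x _; rewrite !funeposE.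
Qed.

Let normal_neg :
  (\int[normal_prob m (Num.sqrt D)]_x ((fun x => (x - m)%:E)^\- x) =
   \int[normal_prob 0 (Num.sqrt D)]_x (EFin^\- x))%E.
Proof.
rewrite -(integral_normal_centered m sqrtD_neq0 mneg (funeneg_ge0 _)).
by apply: eq_integral => x _; rewrite !funenegE.
Qed.

Lemma income_deviation_lty a :
  (\int[income D mu1 m a]_x ((fun x => (deviation (a, x))%:E)^\+ x) < +oo)%E.
Proof.
case: a; rewrite /income /deviation /=.
- rewrite normal_pos.
  have mlr : measurable_fun [set: measurableTypeR R]
      (fun x => (lratio D D x 1)%:E).
    exact/measurable_EFinP/measurable_lratio.
  have lr0 x : (0 <= (lratio D D x 1)%:E)%E by rewrite lee_fin lratio_ge0.
  (* The exponential dominates the positive part and is, up to a constant, the likelihood ratio of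
     the mean [D], whose integral is 1. *)
  have key (x : R) : Num.max x 0 <= expR (2^-1 * D) * lratio D D x 1.
    have -> : expR (2^-1 * D) * lratio D D x 1 = expR x.
      by rewrite /lratio -expRD; congr expR; field; rewrite gt_eqF.
    rewrite ge_max; apply/andP; split; last exact: expR_ge0.
    by apply: le_trans (expR_ge1Dx x); rewrite lerDr.
  apply: (@le_lt_trans _ _
    (\int[normal_prob 0 (Num.sqrt D)]_x
       ((expR (2^-1 * D))%:E * (lratio D D x 1)%:E))%E).
    refine (ge0_le_integral _ measurableT
      (fun x _ => funepos_ge0 _ x) mpos _ _).
    + exact: (measurable_funeM _ mlr).
    + by move=> x _; rewrite funeposE -EFinM -EFin_max lee_fin; exact: key.
  have c0 : (0 <= (expR (2^-1 * D))%:E)%E by rewrite lee_fin expR_ge0.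
  rewrite (ge0_integralZl _ measurableT mlr (fun x _ => lr0 x) c0).
  have := integral_normal_lratio D D0 (@ltr01 R); rewrite mul1r => ->.
  by rewrite mule1 ltry.
- under eq_integral do rewrite funeposE subr0 -funeposE.
  exact: (integrable_lty _ (integrable_funepos measurableT imu1)).
Qed.

(** For the action 2 this is the symmetry of the centered normal law; for the action 1 it is the
    vanishing mean of [mu1], the negative part being of finite integral. *)
Lemma income_deviation_pos_neg a :
  (\int[income D mu1 m a]_x ((fun x => (deviation (a, x))%:E)^\+ x) =
   \int[income D mu1 m a]_x ((fun x => (deviation (a, x))%:E)^\- x))%E.
Proof.
case: a; rewrite /income /deviation /=.
- apply: (etrans normal_pos); apply: esym; apply: (etrans normal_neg).
  rewrite -[RHS](integral_normal_oppr sqrtD_neq0 mpos (funepos_ge0 _)).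
  by apply: eq_integral => x _; rewrite funeposE funenegE EFinN.
- under eq_integral do rewrite funeposE subr0 -funeposE.
  under [RHS]eq_integral do rewrite funenegE subr0 -funenegE.
  have fn := integrable_neg_fin_num measurableT imu1.
  have e : (\int[mu1]_x (EFin^\+ x) - \int[mu1]_x (EFin^\- x) = 0)%E.
    by rewrite -[LHS]integralE.
  by rewrite -[LHS](subeK _ fn) e add0e.
Qed.

End mean_income.

Definition regret {R : realType} (a : bool) (m : R) : R :=
  Num.max 0 (if a then - m else m).

Lemma regret_ge0 {R : realType} a (m : R) : 0 <= regret a m.
Proof. by rewrite /regret le_max lexx. Qed.

Lemma measurable_regret {R : realType} a :
  measurable_fun [set: R] (@regret R a).
Proof. by case: a; apply: measurable_maxr. Qed.

Section total_regret.
Context {R : realType} (n : nat).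
Implicit Types (h : n.-tuple (bool * R)) (m : R).

Definition total_regret h m : R :=
  (nb_first h)%:R * regret false m + (nb_second h)%:R * regret true m.

Lemma total_regret_ge0 h m : 0 <= total_regret h m.
Proof. by rewrite addr_ge0// mulr_ge0// regret_ge0. Qed.

Lemma total_regret_le h m : total_regret h m <= n%:R * `|m|.
Proof.
rewrite -[X in _ <= X%:R * _](nb_firstDsecond h) natrD mulrDl.
rewrite /total_regret /regret.
by rewrite lerD// ler_wpM2l// ge_max normr_ge0/= ?ler_norm// -normrN ler_norm.
Qed.

Lemma measurable_total_regret m :
  measurable_fun [set: _] (fun h => (total_regret h m)%:E).
Proof.
apply/measurable_EFinP/measurable_funD; apply: measurable_funM => //.
- exact: measurable_nb_firstR.
- exact: measurable_nb_secondR.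
Qed.

End total_regret.

Section loss.
Context {R : realType}.
Variables (D m : R) (mu1 : probability (measurableTypeR R) R).
Variables (M : nat) (sigma : @strategy R).
Hypotheses (D0 : 0 < D)
  (imu1 : mu1.-integrable [set: R] (fun x : R => x%:E))
  (mean_mu1 : (\int[mu1]_x x%:E = 0)%E).
Let P := law M sigma (income D mu1 m).

Let integral_P n (F : n.+1.-tuple (bool * R) -> \bar R) :
  measurable_fun [set: _] F -> (forall h, 0 <= F h)%E ->
  (\int[P n.+1]_h F h = \int[P n]_h \int[selection M sigma h]_a
     \int[income D mu1 m a]_x F [tuple of rcons h (a, x)])%E.
Proof. exact: ge0_integral_next_law. Qed.

(** The laws are consistent: [P n] is the marginal of [P n.+1] on the first n steps, since the
    selection and the income have mass 1. *)
Let integral_init n (F : n.+1.-tuple (bool * R) -> \bar R)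
    (G : n.-tuple (bool * R) -> \bar R) :
  measurable_fun [set: _] F -> (forall h, 0 <= F h)%E ->
  (forall (h : n.-tuple (bool * R)) z, F [tuple of rcons h z] = G h) ->
  (\int[P n.+1]_h F h = \int[P n]_h G h)%E.
Proof.
move=> mF F0 FG; rewrite (integral_P mF F0).
apply: eq_integral => h _.
rewrite (eq_integral (cst (G h))).
  by rewrite integral_cst// prob_kernel mule1.
move=> a _; rewrite (eq_integral (cst (G h))).
  rewrite integral_cst//.
  by rewrite [X in (_ * X)%E](probability_setT (income D mu1 m a)) mule1.
by move=> x _; rewrite FG.
Qed.

Let total_deviation n (h : n.-tuple (bool * R)) : R :=
  \sum_(i < n) deviation m (tnth h i).

Let measurable_deviation : measurable_fun [set: bool * R] (deviation m).
Proof.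
apply: measurable_funB => //.
by apply: measurable_fun_ifT.
Qed.

Let integral_total_deviation n :
  (P n).-integrable [set: _] (EFin \o @total_deviation n) /\
  (\int[P n]_h (total_deviation h)%:E = 0)%E.
Proof.
elim: n => [|n [IH1 IH2]].
  rewrite (_ : EFin \o _ = cst 0%E); last first.
    by apply/funext => h; rewrite /total_deviation/= big_ord0.
  split; first exact: integrable0.
  by apply: integral0_eq => h _; rewrite /total_deviation big_ord0.
(* Past and last deviation. Consistency reduces [A] to the induction hypothesis; for [B] the two
   parts already have equal integrals over the income, whichever action is selected. *)
pose A (h : n.+1.-tuple (bool * R)) : R :=
  \sum_(i < n) deviation m (tnth h (widen_ord (leqnSn n) i)).
pose B (h : n.+1.-tuple (bool * R)) : R := deviation m (tnth h ord_max).
have mA : measurable_fun [set: _] (EFin \o A).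
  apply/measurable_EFinP/measurable_sum => i.
  exact: (measurableT_comp measurable_deviation (measurable_tnth _)).
have mB : measurable_fun [set: _] B.
  exact: (measurableT_comp measurable_deviation (measurable_tnth _)).
have AE (h : n.-tuple (bool * R)) z :
    A [tuple of rcons h z] = total_deviation h.
  apply: eq_bigr => i _; congr deviation.
  by rewrite !(tnth_nth z) /= nth_rcons size_tuple ltn_ord.
have BE (h : n.-tuple (bool * R)) z : B [tuple of rcons h z] = deviation m z.
  by rewrite /B (tnth_nth z) /= nth_rcons size_tuple ltnn eqxx.
have iA : (P n.+1).-integrable [set: _] (EFin \o A).
  apply/integrableP; split => //.
  have /integrableP[_] := IH1.
  rewrite -(@integral_init n (fun h => `|(A h)%:E|)%E)//.
    exact: measurableT_comp.
  by move=> h z; rewrite AE.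
have intA : (\int[P n.+1]_h (A h)%:E = 0)%E.
  rewrite -[RHS]IH2 [LHS]integralE [RHS]integralE; congr (_ - _)%E.
  - apply: integral_init => //; first exact: measurable_funepos.
    by move=> h z; rewrite !funeposE/= AE.
  - apply: integral_init => //; first exact: measurable_funeneg.
    by move=> h z; rewrite !funenegE/= AE.
have [iB intB] : (P n.+1).-integrable [set: _] (EFin \o B) /\
    (\int[P n.+1]_h (B h)%:E = 0)%E.
  have mBp : measurable_fun [set: _] (EFin \o B)^\+%E.
    exact/measurable_funepos/measurable_EFinP.
  have mBn : measurable_fun [set: _] (EFin \o B)^\-%E.
    exact/measurable_funeneg/measurable_EFinP.
  apply: funepos_neg_centered => //.
  - rewrite (integral_P mBp (fun h => funepos_ge0 _ h)).
    rewrite (integral_P mBn (fun h => funeneg_ge0 _ h)).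
    apply: eq_integral => h _; apply: eq_integral => a _.
    apply: etrans (etrans (income_deviation_pos_neg m D0 imu1 mean_mu1 a) _).
      by apply: eq_integral => x _; rewrite !funeposE/= BE.
    by apply: eq_integral => x _; rewrite !funenegE/= BE.
  (* The selected action is random; the sum of both bounds dominates the inner integral in either
     case. *)
  - pose b a := (\int[income D mu1 m a]_x
      ((fun x => (deviation m (a, x))%:E)^\+ x))%E.
    have b0 a : (0 <= b a)%E by apply: integral_ge0 => x _; exact: funepos_ge0.
    have blty : (b true + b false < +oo)%E.
      by apply: lte_add_pinfty; exact: income_deviation_lty.
    have bb0 : (0 <= b true + b false)%E by exact: adde_ge0.
    have sel1 (h : n.-tuple (bool * R)) : selection M sigma h [set: bool] = 1%E.
      by rewrite prob_kernel.
    apply: le_lt_trans blty.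
    rewrite (integral_P mBp (fun h => funepos_ge0 _ h)).
    rewrite -[leRHS]mule1 -(probability_setT (P n)) -integral_cst//.
    apply: (ge0_le_integral _ measurableT).
    + move=> h _; apply: integral_ge0 => a _; apply: integral_ge0 => x _.
      exact: funepos_ge0.
    + exact: (measurable_integral_step _ _ _ mBp (fun h => funepos_ge0 _ h)).
    + exact: measurable_cst.
    + move=> h _; rewrite /cst -[leRHS]mule1 -(sel1 h).
      rewrite -integral_cst//; apply: (ge0_le_integral _ measurableT).
      * by move=> a _; apply: integral_ge0 => x _; exact: funepos_ge0.
      * by [].
      * exact: measurable_cst.
      * move=> a _; apply: (@le_trans _ _ (b a)).
          by rewrite le_eqVlt; apply/orP; left; apply/eqP;
            apply: eq_integral => x _; rewrite !funeposE/= BE.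
        by case: a; rewrite /cst; [apply: leeDl|apply: leeDr].
have e : EFin \o @total_deviation n.+1 = (EFin \o A) \+ (EFin \o B).
  by apply/funext => h; rewrite /total_deviation/= big_ord_recr.
rewrite e; split; first exact: integrableD.
rewrite -[RHS]add0e -{1}intA -intB -integralD//.
by apply: eq_integral => h _; rewrite -/((EFin \o @total_deviation n.+1) h) e.
Qed.


Let total_incomeE n (h : n.-tuple (bool * R)) :
  \sum_(i < n) (tnth h i).2 = (nb_second h)%:R * m + total_deviation h.
Proof.
apply/eqP; rewrite -subr_eq; apply/eqP; rewrite /total_deviation -sumrB.
under eq_bigr do rewrite opprB addrC subrK.
rewrite -(big_tuple _ _ h xpredT (fun z : bool * R => if z.1 then m else 0)).
by rewrite -big_mkcond /= big_const_seq iter_addr_0 mulr_natl.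
Qed.

Let total_regretE n (h : n.-tuple (bool * R)) :
  total_regret h m = n%:R * Num.max 0 m - (nb_second h)%:R * m.
Proof.
rewrite -{2}(nb_firstDsecond h) natrD /total_regret /regret.
have [m0|/ltW m0] := leP 0 m.
  by rewrite max_l ?oppr_le0//; ring.
by rewrite max_r ?oppr_ge0//; ring.
Qed.

(** A form of Wald's identity: the deviations have total mean 0, so the expected income is [m] times
    the expected number of uses of the action 2. *)
Lemma loss_total_regret N :
  (\int[law M sigma (income D mu1 m) N]_h (total_regret h m)%:E =
   (loss D N M mu1 sigma m)%:E)%E.
Proof.
have [iS S0] := integral_total_deviation N.
pose second h : R := (@nb_second R N h)%:R * m.
have i2 : (P N).-integrable [set: _] (EFin \o second).
  apply: (le_integrable measurableT (g := cst (N%:R * `|m|)%:E)).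
  - apply/measurable_EFinP; apply: measurable_funM => //.
    exact: measurable_nb_secondR.
  - move=> h _ /=; rewrite lee_fin !normrM !normr_nat normr_id.
    by rewrite ler_wpM2r// ler_nat -[leqRHS](nb_firstDsecond h) leq_addl.
  - exact: finite_measure_integrable_cst.
have icst : (P N).-integrable [set: _] (cst (N%:R * Num.max 0 m)%:E).
  exact: finite_measure_integrable_cst.
have fin2 : (\int[P N]_h (second h)%:E \is a fin_num)%E.
  exact: integrable_fin_num.
have mean : ('E_(P N)[fun w => (\sum_(i < N) (tnth w i).2)%R] =
    \int[P N]_h (second h)%:E)%E.
  rewrite -[RHS]adde0 -S0 -integralD// unlock.
  by apply: eq_integral => h _; rewrite total_incomeE.
transitivity (\int[P N]_h (cst (N%:R * Num.max 0 m)%:E h - (second h)%:E))%E.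
  by apply: eq_integral => h _; rewrite total_regretE.
rewrite integralB// integral_cst//.
rewrite [X in (_ * X)%E](probability_setT (P N)) mule1.
by rewrite /loss -/(P N) mean EFinB fineK.
Qed.

End loss.

(** * The Bayesian loss under the reference measure *)

Section bayes_loss.
Context {R : realType} (D : R).
Local Notation mu := (@lebesgue_measure R).

(* Total regret of the action [a], integrated over the unnormalized posterior
   density of m after n observations with sum X. *)
Definition posterior_regret (lam : R -> R) (a : bool) (X n : R) : \bar R :=
  (\int[mu]_m (regret a m * lratio D m X n * lam m)%:E)%E.

Definition posterior_cost (lam : R -> R) (k n : nat) (X : R) : \bar R :=
  (k%:R%:E * posterior_regret lam false X n%:R +
   n%:R%:E * posterior_regret lam true X n%:R)%E.

Variables (lam : R -> R).
Hypotheses (mlam : measurable_fun [set: measurableTypeR R] lam)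
  (lam0 : forall m, 0 <= lam m).

Lemma regret_density_ge0 a (m X n : R) :
  (0 <= (regret a m * lratio D m X n * lam m)%:E)%E.
Proof. by rewrite lee_fin !mulr_ge0// ?regret_ge0 ?lratio_ge0. Qed.

Lemma measurable_regret_density a d (T : measurableType d) (m X n : T -> R) :
  measurable_fun [set: T] m -> measurable_fun [set: T] X ->
  measurable_fun [set: T] n -> measurable_fun [set: T]
    (fun t => (regret a (m t) * lratio D (m t) (X t) (n t) * lam (m t))%:E).
Proof.
move=> mm mX mn; apply/measurable_EFinP/measurable_funM.
  apply: measurable_funM; last exact: measurable_lratio.
  exact: (measurableT_comp (measurable_regret a)).
exact: (measurableT_comp mlam).
Qed.

Lemma posterior_regret_ge0 a X n : (0 <= posterior_regret lam a X n)%E.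
Proof. by apply: integral_ge0 => m _; exact: regret_density_ge0. Qed.

Lemma posterior_cost_ge0 k n X : (0 <= posterior_cost lam k n X)%E.
Proof.
by rewrite /posterior_cost adde_ge0// mule_ge0// posterior_regret_ge0.
Qed.

Lemma measurable_posterior_regret a n :
  measurable_fun [set: measurableTypeR R] (posterior_regret lam a ^~ n).
Proof.
have mf : measurable_fun [set: measurableTypeR R * measurableTypeR R]
    (fun u : measurableTypeR R * measurableTypeR R =>
      (regret a u.2 * lratio D u.2 u.1 n * lam u.2)%:E).
  by apply: measurable_regret_density => //; exact: measurable_cst.
exact: (measurable_fun_fubini_tonelli_F (m2 := mu) _ mf
  (fun=> regret_density_ge0 _ _ _ _)).
Qed.

Lemma measurable_posterior_cost k n :
  measurable_fun [set: measurableTypeR R] (posterior_cost lam k n).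
Proof.
by apply: emeasurable_funD; apply: measurable_funeM;
  exact: measurable_posterior_regret.
Qed.

Variables (M : nat) (mu1 : probability (measurableTypeR R) R).
Variable sigma : @strategy R.
Hypotheses (D0 : 0 < D)
  (imu1 : mu1.-integrable [set: R] (fun x : R => x%:E))
  (mean_mu1 : (\int[mu1]_x x%:E = 0)%E).

Local Notation P := (law M sigma (income D mu1 0)).

(** Measurability of the loss in [m] comes as a by-product: after the change of measure the weighted
    loss is an inner integral, over histories, of the jointly measurable [F]. *)
Lemma integral_posterior_cost N :
  measurable_fun [set: measurableTypeR R]
    (fun m => (loss D N M mu1 sigma m * lam m)%:E) /\
  (\int[P N]_h posterior_cost lam (nb_first h) (nb_second h) (cum_second h) =
   \int[mu]_m (loss D N M mu1 sigma m * lam m)%:E)%E.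
Proof.
have mX : measurable_fun [set: measurableTypeR R * N.-tuple (bool * R)]
    (fun u : measurableTypeR R * N.-tuple (bool * R) => cum_second u.2).
  exact: (measurableT_comp (@measurable_cum_second R N) measurable_snd).
have m1 : measurable_fun [set: measurableTypeR R * N.-tuple (bool * R)]
    (fun u : measurableTypeR R * N.-tuple (bool * R) => (nb_first u.2)%:R : R).
  exact: (measurableT_comp (@measurable_nb_firstR R N) measurable_snd).
have m2 : measurable_fun [set: measurableTypeR R * N.-tuple (bool * R)]
    (fun u : measurableTypeR R * N.-tuple (bool * R) => (nb_second u.2)%:R : R).
  exact: (measurableT_comp (@measurable_nb_secondR R N) measurable_snd).
pose F (u : measurableTypeR R * N.-tuple (bool * R)) : \bar R :=
  ((nb_first u.2)%:R%:E *
     (regret false u.1 * lratio D u.1 (cum_second u.2) (nb_second u.2)%:R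
       * lam u.1)%:E +
   (nb_second u.2)%:R%:E *
     (regret true u.1 * lratio D u.1 (cum_second u.2) (nb_second u.2)%:R
       * lam u.1)%:E)%E.
have F0 u : (0 <= F u)%E by rewrite /F adde_ge0// mule_ge0// regret_density_ge0.
have mF : measurable_fun setT F.
  apply: emeasurable_funD; apply: emeasurable_funM.
  - exact/measurable_EFinP.
  - exact: measurable_regret_density.
  - exact/measurable_EFinP.
  - exact: measurable_regret_density.
have lossE m : (\int[P N]_h F (m, h) = (loss D N M mu1 sigma m * lam m)%:E)%E.
  rewrite EFinM -(loss_total_regret m M sigma D0 imu1 mean_mu1).
  have mr := @measurable_total_regret R N m.
  have ml : measurable_fun [set: N.-tuple (bool * R)]
      (fun h => (lratio D m (cum_second h) (nb_second h)%:R)%:E).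
    apply/measurable_EFinP/measurable_lratio => //.
      exact: measurable_cum_second.
    exact: measurable_nb_secondR.
  have r0 (h : N.-tuple (bool * R)) : (0 <= (total_regret h m)%:E)%E.
    by rewrite lee_fin total_regret_ge0.
  apply: esym; apply: etrans (congr1 (fun z => z * (lam m)%:E)%E
    (ge0_integral_law_lratio _ _ _ D0 m mr r0)) _.
  have l0 : (0 <= (lam m)%:E)%E by rewrite lee_fin.
  rewrite -(ge0_integralZr _ measurableT _ _ l0); last 2 first.
  - exact: emeasurable_funM.
  - by move=> h _; rewrite mule_ge0// lee_fin lratio_ge0.
  apply: eq_integral => h _; rewrite /F /= /total_regret -!EFinM -EFinD.
  by congr EFin; ring.
split.
  apply: eq_measurable_fun
    (measurable_fun_fubini_tonelli_F (m2 := P N) _ mF F0).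
  by move=> m _; rewrite /fubini_F lossE.
transitivity (\int[P N]_h \int[mu]_m F (m, h))%E.
  apply: eq_integral => h _; rewrite /F /=.
  have md a : measurable_fun [set: measurableTypeR R] (fun m : R =>
      (regret a m * lratio D m (cum_second h) (nb_second h)%:R * lam m)%:E).
    by apply: measurable_regret_density => //; exact: measurable_cst.
  have d0 a (m : R) : setT m -> (0 <=
      (regret a m * lratio D m (cum_second h) (nb_second h)%:R * lam m)%:E)%E.
    by move=> _; exact: regret_density_ge0.
  have c0 (k : nat) : (0 <= (k%:R : R)%:E)%E by rewrite lee_fin.
  rewrite /posterior_cost /posterior_regret.
  rewrite -(ge0_integralZl _ measurableT (md false) (d0 false) (c0 _)).
  rewrite -(ge0_integralZl _ measurableT (md true) (d0 true) (c0 _)).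
  rewrite (ge0_integralD _ measurableT)//.
  - by move=> m _; rewrite mule_ge0// d0.
  - exact: measurable_funeM.
  - by move=> m _; rewrite mule_ge0// d0.
  - exact: measurable_funeM.
rewrite -(fubini_tonelli _ mF F0).
by apply: eq_integral => m _; exact: lossE.
Qed.

Variable C : R.
Hypotheses (C0 : 0 <= C) (lamC : forall m, C < `|m| -> lam m = 0)
  (lam1 : (\int[mu]_m (lam m)%:E < +oo)%E).

(** [bayes_loss] is the [fine] of an integral, which determines that integral only if it is finite.
    A step costs at most [|m|], hence at most [C] on the support of the prior. *)
Lemma integral_posterior_cost_lty N :
  (\int[P N]_h posterior_cost lam (nb_first h) (nb_second h) (cum_second h)
   < +oo)%E.
Proof.
have [mloss ->] := integral_posterior_cost N.
have loss0 m : 0 <= loss D N M mu1 sigma m.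
  rewrite -lee_fin -(loss_total_regret m M sigma D0 imu1 mean_mu1).
  by apply: integral_ge0 => h _; rewrite lee_fin total_regret_ge0.
have loss_le m : loss D N M mu1 sigma m <= N%:R * `|m|.
  rewrite -lee_fin -(loss_total_regret m M sigma D0 imu1 mean_mu1).
  rewrite -[leRHS]mule1 -(probability_setT (law M sigma (income D mu1 m) N)).
  rewrite -integral_cst//; apply: (ge0_le_integral _ measurableT).
  - by move=> h _; rewrite lee_fin total_regret_ge0.
  - exact: measurable_total_regret.
  - exact: measurable_cst.
  - by move=> h _; rewrite lee_fin total_regret_le.
have NC0 : (0 <= (N%:R * C)%:E)%E by rewrite lee_fin mulr_ge0.
have mE : measurable_fun [set: measurableTypeR R] (EFin \o lam).
  exact/measurable_EFinP.
have E0 m : (0 <= (lam m)%:E)%E by rewrite lee_fin.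
apply: (@le_lt_trans _ _ (\int[mu]_m ((N%:R * C)%:E * (lam m)%:E))%E).
  apply: (ge0_le_integral _ measurableT _ mloss).
  - by move=> m _; rewrite lee_fin mulr_ge0.
  - exact: (measurable_funeM _ mE).
  - move=> m _; rewrite -EFinM lee_fin.
    have [mC|/lamC ->] := leP `|m| C; last by rewrite !mulr0.
    rewrite ler_wpM2r//; apply: le_trans (loss_le m) _.
    by rewrite ler_wpM2l.
rewrite (ge0_integralZl _ measurableT mE (fun m _ => E0 m) NC0).
by apply: lte_mul_pinfty.
Qed.

End bayes_loss.

(** * Gaussian increments *)

Section gaussian_convolution.
Context {R : realType}.
Local Notation mu := (@lebesgue_measure R).

(* Completing the square in y. *)
Lemma normal_pdf_mul (a b u y : R) : 0 < a -> 0 < b ->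
  normal_pdf 0 (Num.sqrt b) (u - y) * normal_pdf 0 (Num.sqrt a) y =
  normal_pdf 0 (Num.sqrt (a + b)) u *
  normal_pdf (u * a / (a + b)) (Num.sqrt (a * b / (a + b))) y.
Proof.
move=> a0 b0; have ab0 : 0 < a + b by exact: addr_gt0.
have c0 : 0 < a * b / (a + b) by rewrite divr_gt0// mulr_gt0.
rewrite !normal_pdfE ?gt_eqF ?sqrtr_gt0//.
rewrite mulrACA [RHS]mulrACA; congr (_ * _).
  rewrite /normal_peak !sqr_sqrtr ?ltW// -!invfM; congr (_^-1).
  have pi2 : 0 <= pi *+ 2 :> R by rewrite mulrn_wge0 ?pi_ge0.
  rewrite -!mulrnAr -!sqrtrM ?(mulr_ge0 (ltW _) pi2)//.
  by congr Num.sqrt; field; rewrite gt_eqF.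
rewrite /normal_fun !sqr_sqrtr ?ltW// -!expRD; congr expR.
by field; rewrite !gt_eqF.
Qed.

(** After the substitution u = y + z and Tonelli's theorem, [normal_pdf_mul] leaves in y a normal
    density, of mass 1. *)
Lemma ge0_integral_normal_convolution (a b : R) (f : R -> \bar R) :
  0 < a -> 0 < b -> measurable_fun [set: measurableTypeR R] f ->
  (forall x, 0 <= f x)%E ->
  (\int[normal_prob 0 (Num.sqrt a)]_y
     \int[normal_prob 0 (Num.sqrt b)]_z f (y + z)%R =
   \int[normal_prob 0 (Num.sqrt (a + b))]_u f u)%E.
Proof.
move=> a0 b0 mf f0.
have mnpdf s c : measurable_fun [set: measurableTypeR R]
    (fun x => (normal_pdf c s x)%:E).
  by apply/measurable_EFinP; exact: measurable_normal_pdf.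
have pdf0 c s x : (0 <= (normal_pdf c s x)%:E :> \bar R)%E.
  by rewrite lee_fin normal_pdf_ge0.
pose F (w : measurableTypeR R * measurableTypeR R) : \bar R :=
  (f w.2 * (normal_pdf 0 (Num.sqrt b) (w.2 - w.1))%:E *
   (normal_pdf 0 (Num.sqrt a) w.1)%:E)%E.
have F0 w : (0 <= F w)%E by rewrite /F !mule_ge0.
have mF : measurable_fun setT F.
  apply: emeasurable_funM; last exact: (measurableT_comp (mnpdf _ _)).
  apply: emeasurable_funM; first exact: (measurableT_comp mf).
  apply: (measurableT_comp (mnpdf (Num.sqrt b) 0)).
  by apply: measurable_funB.
have mshift y : measurable_fun [set: measurableTypeR R] (fun z => f (y + z)%R).
  by apply: measurableT_comp => //; exact: measurable_funD.
transitivity (\int[mu]_y \int[mu]_u F (y, u))%E.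
  have mint : measurable_fun [set: measurableTypeR R]
      (fun y => \int[normal_prob 0 (Num.sqrt b)]_z f (y + z)%R)%E.
    have mg : measurable_fun [set: measurableTypeR R * measurableTypeR R]
        (fun w : measurableTypeR R * measurableTypeR R => f (w.1 + w.2)%R).
      by apply: (measurableT_comp mf); exact: measurable_funD.
    exact: (measurable_fun_fubini_tonelli_F
      (m2 := normal_prob 0 (Num.sqrt b)) _ mg (fun=> f0 _)).
  rewrite (ge0_integral_normal_prob _ _ mint); last first.
    by move=> y; apply: integral_ge0 => z _; exact: f0.
  apply: eq_integral => y _.
  rewrite (ge0_integral_normal_prob _ _ (mshift y) (fun=> f0 _)).
  rewrite -(ge0_integralZr _ measurableT _ _ (pdf0 _ _ _)); last 2 first.
    exact: (emeasurable_funM (mshift y) (mnpdf _ _)).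
    by move=> z _; rewrite mule_ge0.
  have mFy : measurable_fun [set: measurableTypeR R] (fun u => F (y, u)).
    exact: (measurableT_comp mF (measurable_pair1 y)).
  rewrite -[RHS](ge0_integral_translation y mFy (fun=> F0 _)).
  by apply: eq_integral => z _; rewrite /F /= addrK addrC.
rewrite (fubini_tonelli _ mF F0) (ge0_integral_normal_prob _ _ mf f0).
apply: eq_integral => u _.
transitivity (\int[mu]_y (f u * (normal_pdf 0 (Num.sqrt (a + b)) u)%:E *
    (normal_pdf (u * a / (a + b)) (Num.sqrt (a * b / (a + b))) y)%:E))%E.
  apply: eq_integral => y _; rewrite /F /= -!muleA; congr (_ * _)%E.
  by rewrite -!EFinM normal_pdf_mul.
rewrite (ge0_integralZl _ measurableT (mnpdf _ _)) ?mule_ge0//.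
by rewrite integral_normal_pdf mule1.
Qed.

End gaussian_convolution.

Section posterior.
Context {R : realType} (D C : R) (lam : R -> R).
Local Notation mu := (@lebesgue_measure R).
Hypotheses (D0 : 0 < D) (C0 : 0 <= C).
Hypotheses (mlam : measurable_fun [set: measurableTypeR R] lam)
  (lam0 : forall m, 0 <= lam m) (lamC : forall m, C < `|m| -> lam m = 0)
  (lam_lty : (\int[mu]_m (lam m)%:E < +oo)%E).

Lemma posterior_regret_fin_num a X n : 0 <= n ->
  (posterior_regret D lam a X n \is a fin_num)%E.
Proof.
move=> n0; rewrite ge0_fin_numE ?posterior_regret_ge0//.
have mE : measurable_fun [set: measurableTypeR R] (EFin \o lam).
  exact/measurable_EFinP.
(* Where the prior does not vanish [|m| <= C], which bounds the regret and the linear term of the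
   exponent; the quadratic term is dropped, as [0 <= n]. *)
pose B : R := C * expR (D^-1 * (`|X| * C)).
have B0 : (0 <= B%:E)%E by rewrite lee_fin mulr_ge0// expR_ge0.
apply: (@le_lt_trans _ _ (\int[mu]_m (B%:E * (lam m)%:E))%E).
  apply: (ge0_le_integral _ measurableT).
  - by move=> m _; exact: regret_density_ge0.
  - by apply: measurable_regret_density => //; exact: measurable_cst.
  - exact: (measurable_funeM _ mE).
  - move=> m _; rewrite -EFinM lee_fin.
    have [mC|/lamC ->] := leP `|m| C; last by rewrite !mulr0.
    apply: ler_wpM2r => //; apply: ler_pM.
    + exact: regret_ge0.
    + exact: lratio_ge0.
    + rewrite /regret ge_max C0 /=; apply: le_trans mC.
      by case: a; rewrite ?ler_norm// -normrN ler_norm.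
    + rewrite ler_expR ler_pM2l ?invr_gt0//.
      apply: (@le_trans _ _ (X * m)).
        by rewrite lerBlDr lerDl mulr_ge0 ?sqr_ge0// mulr_ge0 ?invr_ge0.
      by rewrite (le_trans (ler_norm _))// normrM ler_wpM2l.
rewrite (ge0_integralZl _ measurableT mE (fun m _ => lam0 m) B0).
exact: lte_mul_pinfty.
Qed.

(** By Tonelli's theorem [m] can be fixed; the likelihood ratio of the increment then factors out
    and has integral 1. *)
Lemma integral_normal_posterior_regret a X p n : 0 < n ->
  (\int[normal_prob 0 (Num.sqrt (n * D))]_y
     posterior_regret D lam a (X + y) (p + n) =
   posterior_regret D lam a X p)%E.
Proof.
move=> n0.
pose F (w : measurableTypeR R * measurableTypeR R) : \bar R :=
  (regret a w.2 * lratio D w.2 (X + w.1) (p + n) * lam w.2)%:E.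
have F0 w : (0 <= F w)%E by exact: regret_density_ge0.
have mF : measurable_fun setT F.
  have mX : measurable_fun [set: measurableTypeR R * measurableTypeR R]
      (fun w : measurableTypeR R * measurableTypeR R => X + w.1).
    exact: (measurable_funD (measurable_cst _) measurable_fst).
  exact: (measurable_regret_density D mlam a measurable_snd mX
    (measurable_cst (p + n))).
have mlr m : measurable_fun [set: measurableTypeR R]
    (fun y => (lratio D m y n)%:E).
  exact/measurable_EFinP/measurable_lratio.
have lr0 m y : (0 <= (lratio D m y n)%:E)%E by rewrite lee_fin lratio_ge0.
transitivity (\int[normal_prob 0 (Num.sqrt (n * D))]_y \int[mu]_m F (y, m))%E.
  by [].
rewrite (fubini_tonelli _ mF F0); apply: eq_integral => m _.
transitivity (\int[normal_prob 0 (Num.sqrt (n * D))]_y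
  ((regret a m * lratio D m X p * lam m)%:E * (lratio D m y n)%:E))%E.
  apply: eq_integral => y _; rewrite /F /= lratioD -EFinM; congr EFin; ring.
rewrite (ge0_integralZl _ measurableT (mlr m) (fun y _ => lr0 m y)).
  by rewrite integral_normal_lratio// mule1.
exact: regret_density_ge0.
Qed.

End posterior.

(** * Backward induction *)

Section history_functions.
Context {R : realType} (f : nat -> nat -> R -> bool -> \bar R).
Hypothesis mf : forall k n b,
  measurable_fun [set: measurableTypeR R] (fun X => f k n X b).

Definition of_history N (h : N.-tuple (bool * R)) : \bar R :=
  f (nb_first h) (nb_second h) (cum_second h) (last_action h).

Lemma measurable_of_history N : measurable_fun [set: _] (@of_history N).
Proof.
pose A k l := [set h : N.-tuple (bool * R) | nb_first h = k /\ nb_second h = l].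
have mA k l : measurable (A k l).
  apply: measurableI.
    rewrite -[X in measurable X]setTI.
    exact: (measurable_nb_first measurableT (Y := [set k])).
  rewrite -[X in measurable X]setTI.
  exact: (measurable_nb_second measurableT (Y := [set l])).
(* The dependence on the two counts is arbitrary, but they take countably many values, and on each
   piece only [X] and a boolean vary. *)
rewrite (_ : [set: _] = \bigcup_k \bigcup_l A k l); last first.
  apply/esym; rewrite -subTset => h _.
  by exists (nb_first h) => //; exists (nb_second h).
apply/measurable_fun_bigcup => k; first exact: bigcupT_measurable.
apply/measurable_fun_bigcup => l //.
apply: (eq_measurable_fun (fun h => if last_action h then
    f k l (cum_second h) true else f k l (cum_second h) false)).
  by move=> h; rewrite inE /of_history => -[-> ->]; case: last_action.
apply: measurable_funTS; apply: measurable_fun_ifT.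
- exact: measurable_last_action.
- exact: (measurableT_comp (mf k l true) (@measurable_cum_second R N)).
- exact: (measurableT_comp (mf k l false) (@measurable_cum_second R N)).
Qed.

End history_functions.

Section optimal_cost.
Context {R : realType} (D : R) (M : nat) (lam : R -> R).

(* Expected value of [f] after one more action [a], under the reference
   measure m = 0. *)
Definition next_cost (f : nat -> nat -> R -> bool -> \bar R)
    (k n : nat) (X : R) (a : bool) : \bar R :=
  (if a then \int[normal_prob 0 (Num.sqrt D)]_y f k n.+1 (X + y)%R true
   else f k.+1 n X false)%E.

(** Bellman's value function with [l] single steps left; [b] is the previous action, repeated unless
    a selection is due. *)
Fixpoint optimal_cost l (k n : nat) (X : R) (b : bool) : \bar R :=
  if l is l'.+1 then
    if (M %| k)%N && (M %| n)%N then
      mine (next_cost (optimal_cost l') k n X false)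
           (next_cost (optimal_cost l') k n X true)
    else next_cost (optimal_cost l') k n X b
  else posterior_cost D lam k n X.

Lemma optimal_costS l k n X b : optimal_cost l.+1 k n X b =
  if (M %| k)%N && (M %| n)%N then
    mine (next_cost (optimal_cost l) k n X false)
         (next_cost (optimal_cost l) k n X true)
  else next_cost (optimal_cost l) k n X b.
Proof. by []. Qed.

Hypotheses (mlam : measurable_fun [set: measurableTypeR R] lam)
  (lam0 : forall m, 0 <= lam m).

Lemma next_cost_ge0 f k n X a : (forall k n X b, 0 <= f k n X b)%E ->
  (0 <= next_cost f k n X a)%E.
Proof.
by move=> f0; case: a => /=; [apply: integral_ge0 => y _; exact: f0|exact: f0].
Qed.

Lemma measurable_next_cost f k n a : (forall k n X b, 0 <= f k n X b)%E ->
  (forall k n b,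
    measurable_fun [set: measurableTypeR R] (fun X => f k n X b)) ->
  measurable_fun [set: measurableTypeR R] (fun X => next_cost f k n X a).
Proof.
move=> f0 mf; case: a => /=; last exact: mf.
have mg : measurable_fun [set: measurableTypeR R * measurableTypeR R]
    (fun w : measurableTypeR R * measurableTypeR R =>
       f k n.+1 (w.1 + w.2)%R true).
  by apply: (measurableT_comp (mf k n.+1 true)); exact: measurable_funD.
exact: (measurable_fun_fubini_tonelli_F
  (m2 := normal_prob 0 (Num.sqrt D)) _ mg (fun=> f0 _ _ _ _)).
Qed.

Lemma optimal_cost_ge0 l k n X b : (0 <= optimal_cost l k n X b)%E.
Proof.
elim: l k n X b => [|l IH] k n X b; first exact: posterior_cost_ge0.
have nc a := next_cost_ge0 k n X a IH.
by rewrite optimal_costS /Order.min; do 2?[case: ifP => _]; exact: nc.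
Qed.

Lemma measurable_optimal_cost l k n b :
  measurable_fun [set: measurableTypeR R] (fun X => optimal_cost l k n X b).
Proof.
elim: l k n b => [|l IH] k n b; first exact: measurable_posterior_cost.
have mc a := measurable_next_cost k n a (@optimal_cost_ge0 l) IH.
case kn : ((M %| k)%N && (M %| n)%N).
  by under eq_fun do rewrite optimal_costS kn; exact: measurable_mine.
by under eq_fun do rewrite optimal_costS kn; exact: mc.
Qed.

Variables (mu1 : probability (measurableTypeR R) R).

(** The law [mu1] disappears here: a function of the state ignores the incomes of the action 1, so
    only the mass of [mu1] counts. *)
Let integral_income (f : nat -> nat -> R -> bool -> \bar R) N
    (h : N.-tuple (bool * R)) (a : bool) :
  (\int[income D mu1 0 a]_x of_history f [tuple of rcons h (a, x)] =
   next_cost f (nb_first h) (nb_second h) (cum_second h) a)%E.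
Proof.
case: a; rewrite /income /next_cost.
- apply: eq_integral => x _; rewrite /of_history nb_first_rcons nb_second_rcons.
  by rewrite cum_second_rcons last_action_rcons /= addn0 addn1.
- rewrite (eq_integral (cst (f (nb_first h).+1 (nb_second h) (cum_second h)
    false))).
    by rewrite integral_cst// [X in (_ * X)%E](probability_setT mu1) mule1.
  move=> x _; rewrite /of_history nb_first_rcons nb_second_rcons.
  by rewrite cum_second_rcons last_action_rcons /= addn0 addn1 addr0.
Qed.

Local Notation P sigma := (law M sigma (income D mu1 0)).

Let expected_next N (sigma : @strategy R) l (h : N.-tuple (bool * R)) :
    \bar R :=
  (\int[selection M sigma h]_a
     next_cost (optimal_cost l) (nb_first h) (nb_second h) (cum_second h) a)%E.

Let law_optimal_cost sigma N l :
  measurable_fun [set: _] (@expected_next N sigma l) /\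
  (\int[P sigma N.+1]_h of_history (optimal_cost l) h =
   \int[P sigma N]_h expected_next sigma l h)%E.
Proof.
have mW := measurable_of_history (measurable_optimal_cost l) (N := N.+1).
have W0 (h : N.+1.-tuple (bool * R)) : (0 <= of_history (optimal_cost l) h)%E.
  exact: optimal_cost_ge0.
have e (h : N.-tuple (bool * R)) : expected_next sigma l h =
    (\int[selection M sigma h]_a \int[income D mu1 0 a]_x
       of_history (optimal_cost l) [tuple of rcons h (a, x)])%E.
  by apply: eq_integral => a _; rewrite integral_income.
split.
  apply: eq_measurable_fun (measurable_integral_step M sigma _ mW W0).
  by move=> h _; rewrite e.
rewrite (ge0_integral_next_law _ _ _ _ mW W0).
by apply: eq_integral => h _; rewrite e.
Qed.

(** A randomized selection averages the two costs, and an average is at least the minimum. *)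
Let optimal_cost_le_next sigma N l (h : N.-tuple (bool * R)) :
  (of_history (optimal_cost l.+1) h <= expected_next sigma l h)%E.
Proof.
rewrite /of_history optimal_costS /expected_next /selection.
case: ifP => _; last by rewrite integral_dirac// diracT mul1e.
set c := next_cost _ _ _ _; set s := sigma _ _ _.
have c0 a : (0 <= c a)%E by apply: next_cost_ge0 => *; exact: optimal_cost_ge0.
have s1 : s [set: bool] = 1%E by exact: prob_kernel.
rewrite -[leLHS]mule1 -s1 -integral_cst//.
apply: (ge0_le_integral _ measurableT).
- by move=> a _; rewrite /cst /Order.min; case: ifP.
- exact: measurable_cst.
- by [].
- move=> a _; rewrite /cst /Order.min.
  by case: a; case: ltP => // /ltW.
Qed.

(** Verification argument: along any strategy the value of the current state is a submartingale,
    ending at the terminal cost. *)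
Lemma optimal_cost_le_integral sigma N n : (n <= N)%N ->
  (optimal_cost N 0 0 0 false <=
   \int[P sigma n]_h of_history (optimal_cost (N - n)) h)%E.
Proof.
elim: n => [_|n IH nN].
  rewrite subn0 /= integral_dirac//; last first.
    exact: (measurable_of_history (measurable_optimal_cost N)).
  by rewrite diracT mul1e /of_history /cum_second big_nil.
apply: le_trans (IH (ltnW nN)) _.
have [mE ->] := law_optimal_cost sigma n (N - n.+1).
rewrite -subnSK//; apply: (ge0_le_integral _ measurableT _ _ mE).
- by move=> h _; exact: optimal_cost_ge0.
- exact: (measurable_of_history (measurable_optimal_cost _)).
- by move=> h _; exact: optimal_cost_le_next.
Qed.

Section optimal_strategy.
Variable N : nat.

(** The strategy is not given the time, but it is [k + n]; the predecessor appears because the costs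
    are compared after one more step. *)
Definition optimal_action k n X : bool :=
  (next_cost (optimal_cost (N - (k + n)).-1) k n X true <=
   next_cost (optimal_cost (N - (k + n)).-1) k n X false)%E.

Let measurable_optimal_action k n :
  measurable_fun [set: R] (optimal_action k n).
Proof.
have mc a := measurable_next_cost k n a
  (@optimal_cost_ge0 (N - (k + n)).-1) (@measurable_optimal_cost _).
exact: (measurable_fun_lee (mc true) (mc false)).
Qed.

Definition optimal_strategy : @strategy R :=
  fun k n => kdirac (measurable_optimal_action k n).

(** Selecting a minimizer turns the submartingale inequality into an equality at every step. *)
Lemma optimal_cost_integral n : (n <= N)%N ->
  (optimal_cost N 0 0 0 false =
   \int[P optimal_strategy n]_h of_history (optimal_cost (N - n)) h)%E.
Proof.
elim: n => [_|n IH nN].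
  rewrite subn0 /= integral_dirac//; last first.
    exact: (measurable_of_history (measurable_optimal_cost N)).
  by rewrite diracT mul1e /of_history /cum_second big_nil.
rewrite (IH (ltnW nN)).
have [_ ->] := law_optimal_cost optimal_strategy n (N - n.+1).
apply: eq_integral => h _; rewrite -subnSK//.
rewrite /of_history optimal_costS /expected_next /selection.
case: ifP => _; last by rewrite integral_dirac// diracT mul1e.
rewrite /optimal_strategy /kdirac integral_dirac// diracT mul1e.
rewrite /optimal_action nb_firstDsecond -subnS.
by rewrite minC; case: leP.
Qed.

End optimal_strategy.
End optimal_cost.

(** * Batches *)

Section batches.
Context {R : realType} (D : R) (M : nat) (lam : R -> R).
Hypotheses (D0 : 0 < D) (M0 : (0 < M)%N).
Hypotheses (mlam : measurable_fun [set: measurableTypeR R] lam)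
  (lam0 : forall m, 0 <= lam m).
Local Notation V := (optimal_cost D M lam).

(** With [0 < l < M] steps missing from a batch the count is not a multiple of [M], so the action is
    repeated. For [l = M] a selection would take place. *)
Lemma optimal_cost_false_run S l i n X : (l < M)%N ->
  V (S + l) (i * M + (M - l)) n X false = V S (i.+1 * M) n X false.
Proof.
elim: l => [_|l IH lM]; first by rewrite addn0 subn0 mulSn addnC.
rewrite addnS optimal_costS (_ : _ && _ = false) /=; last first.
  rewrite dvdn_addr ?dvdn_mull// gtnNdvd ?subn_gt0//.
  by rewrite ltn_subrL.
by rewrite -addnS subnSK ?IH// ltnW.
Qed.

(* For l = 0 the degenerate law is treated apart: [normal_prob 0 0] is not the
   Dirac mass at 0. *)
Definition normal_shift l (f : R -> \bar R) (X : R) : \bar R :=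
  if l is 0 then f X
  else (\int[normal_prob 0 (Num.sqrt (l%:R * D))]_y f (X + y)%R)%E.

Lemma normal_shiftE l (f : R -> \bar R) (X : R) : (0 < l)%N ->
  (normal_shift l f X =
   \int[normal_prob 0 (Num.sqrt (l%:R * D))]_y f (X + y)%R)%E.
Proof. by case: l. Qed.

Lemma normal_shiftS l (f : R -> \bar R) X :
  measurable_fun [set: measurableTypeR R] f -> (forall x, 0 <= f x)%E ->
  (\int[normal_prob 0 (Num.sqrt D)]_y normal_shift l f (X + y)%R =
   normal_shift l.+1 f X)%E.
Proof.
move=> mf f0; case: l => [|l] /=; first by rewrite mul1r.
have mfX : measurable_fun [set: measurableTypeR R] (fun y => f (X + y)%R).
  by apply: (measurableT_comp mf); exact: measurable_funD.
have lD0 : 0 < l.+1%:R * D by rewrite mulr_gt0.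
have -> : l.+2%:R * D = D + l.+1%:R * D by rewrite -natr1 mulrDl mul1r addrC.
apply: etrans (ge0_integral_normal_convolution D0 lD0 mfX (fun=> f0 _)).
by apply: eq_integral => y _; apply: eq_integral => z _; rewrite addrA.
Qed.

Lemma optimal_cost_true_run S l k j X : (l < M)%N ->
  V (S + l) k (j * M + (M - l)) X true =
  normal_shift l (V S k (j.+1 * M) ^~ true) X.
Proof.
elim: l X => [|l IH] X lM; first by rewrite addn0 subn0 mulSn addnC.
rewrite addnS optimal_costS (_ : _ && _ = false); last first.
  apply/negbTE; rewrite negb_and orbC.
  rewrite dvdn_addr ?dvdn_mull// gtnNdvd ?subn_gt0//.
  by rewrite ltn_subrL.
rewrite -normal_shiftS /next_cost; last 2 first.
- exact: measurable_optimal_cost.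
- by move=> x; exact: optimal_cost_ge0.
by apply: eq_integral => y _; rewrite -addnS subnSK ?IH// ltnW.
Qed.

(** Only the first step of a batch is a choice; the remaining [M.-1] steps are a run, and the first
    increment merges with those of the run. *)
Lemma optimal_cost_batch S i j X b :
  V (S + M) (i * M) (j * M) X b =
  mine (V S (i.+1 * M) (j * M) X false)
    (\int[normal_prob 0 (Num.sqrt (M%:R * D))]_y
       V S (i * M) (j.+1 * M) (X + y)%R true)%E.
Proof.
have M1 : (M.-1 < M)%N by rewrite prednK.
have MM1 : (M - M.-1 = 1)%N by rewrite -{1}(prednK M0) subSnn.
have SM : (S + M = (S + M.-1).+1)%N by rewrite -addnS prednK.
have first_action : V (S + M.-1) (i * M).+1 (j * M) X false =
    V S (i.+1 * M) (j * M) X false.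
  by have := optimal_cost_false_run S i (j * M) X M1; rewrite MM1 addn1.
have second_action : (\int[normal_prob 0 (Num.sqrt D)]_y
      V (S + M.-1) (i * M) (j * M).+1 (X + y)%R true =
    \int[normal_prob 0 (Num.sqrt (M%:R * D))]_y
      V S (i * M) (j.+1 * M) (X + y)%R true)%E.
  apply: etrans (etrans (@normal_shiftS M.-1 (V S (i * M) (j.+1 * M) ^~ true) X
    (measurable_optimal_cost D M mlam lam0 S (i * M) (j.+1 * M) true)
    (fun x => optimal_cost_ge0 D M lam0 S (i * M) (j.+1 * M) x true)) _).
    apply: eq_integral => y _.
    by have := optimal_cost_true_run S (i * M) j (X + y) M1; rewrite MM1 addn1.
  by rewrite (prednK M0) normal_shiftE.
rewrite SM optimal_costS !(dvdn_mull _ (dvdnn M)) /next_cost.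
exact: (congr2 Order.min first_action second_action).
Qed.

Variable C : R.
Hypotheses (C0 : 0 <= C) (lamC : forall m, C < `|m| -> lam m = 0)
  (lam_lty : (\int[lebesgue_measure]_m (lam m)%:E < +oo)%E).

Definition regret_mean (a : bool) (X : R) (n : nat) : R :=
  fine (posterior_regret D lam a X n%:R).

Let regret_meanE a X n :
  (posterior_regret D lam a X n%:R = (regret_mean a X n)%:E)%E.
Proof. by rewrite fineK// (posterior_regret_fin_num D0 C0). Qed.

Let regret_mean_ge0 a X n : 0 <= regret_mean a X n.
Proof. by rewrite fine_ge0// posterior_regret_ge0. Qed.

Let posterior_costE k n X : posterior_cost D lam k n X =
  (k%:R * regret_mean false X n + n%:R * regret_mean true X n)%:E.
Proof. by rewrite /posterior_cost !regret_meanE. Qed.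

Let measurable_regret_mean a n :
  measurable_fun [set: measurableTypeR R] (regret_mean a ^~ n).
Proof.
exact: (measurableT_comp (fine_measurable measurableT)
  (measurable_posterior_regret D mlam lam0 a n%:R)).
Qed.

Local Notation batch := (normal_prob 0 (Num.sqrt (M%:R * D))).

Let integral_regret_mean a X j :
  (\int[batch]_y (regret_mean a (X + y) (j.+1 * M))%:E =
   (regret_mean a X (j * M))%:E)%E.
Proof.
rewrite -[RHS]regret_meanE.
rewrite -(integral_normal_posterior_regret D0 mlam lam0 a X (j * M)%:R
  (n := M%:R)).
  by apply: eq_integral => y _; rewrite -regret_meanE mulSn addnC natrD.
by rewrite ltr0n.
Qed.

Variables (K : nat) (v : nat -> nat -> R -> R).
Hypotheses (vK : forall i j X, (i + j = K)%N -> v i j X = 0)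
  (vlt : forall i j X, (i + j < K)%N ->
    measurable_fun [set: measurableTypeR R] (v i j.+1) ->
    (forall x, 0 <= v i j.+1 x) -> v i j X =
    Num.min (M%:R * regret_mean false X (j * M) + v i.+1 j X)
      (M%:R * regret_mean true X (j * M) +
       fine (\int[batch]_y (v i j.+1 (X + y))%:E)%E)).

(** [posterior_cost] charges the uses already made, and [v] is what remains to be paid. The first
    three clauses are what [vlt] and the convolution require. The upper bound is the cost of using
    the action 1 in all remaining batches; as a multiple of a martingale it stays finite when
    integrated over the next batch. *)
Lemma optimal_cost_dp S i j : (i + j + S = K)%N ->
  [/\ measurable_fun [set: measurableTypeR R] (v i j),
      forall X, 0 <= v i j X,
      forall X, v i j X <= S%:R * (M%:R * regret_mean false X (j * M)) &
      forall X b, (V (S * M) (i * M) (j * M) X b =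
        posterior_cost D lam (i * M) (j * M) X + (v i j X)%:E)%E].
Proof.
elim: S i j => [|S IH] i j ijS.
  have v0 X : v i j X = 0 by rewrite vK// -ijS addn0.
  split.
  - by rewrite (_ : v i j = cst 0)//; apply/funext.
  - by move=> X; rewrite v0.
  - by move=> X; rewrite v0 mul0r.
  - by move=> X b; rewrite v0 adde0.
have ijK : (i + j < K)%N by rewrite -ijS addnS ltnS leq_addr.
have [mv1 v1ge0 v1le V1] := IH i.+1 j (etrans (addSnnS _ _) ijS).
have [mv2 v2ge0 v2le V2] : [/\
    measurable_fun [set: measurableTypeR R] (v i j.+1),
    forall X, 0 <= v i j.+1 X,
    forall X, v i j.+1 X <=
      S%:R * (M%:R * regret_mean false X (j.+1 * M)) &
    forall X b, (V (S * M) (i * M) (j.+1 * M) X b =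
      posterior_cost D lam (i * M) (j.+1 * M) X + (v i j.+1 X)%:E)%E].
  by apply: IH; rewrite addnS addSnnS.
have mshift (f : R -> R) X : measurable_fun [set: measurableTypeR R] f ->
    measurable_fun [set: measurableTypeR R] (fun y => (f (X + y))%:E).
  move=> mf; apply/measurable_EFinP; apply: (measurableT_comp mf).
  exact: measurable_funD.
have int_lty X : (\int[batch]_y (v i j.+1 (X + y))%:E < +oo)%E.
  apply: (@le_lt_trans _ _ (\int[batch]_y ((S%:R * M%:R)%:E *
      (regret_mean false (X + y) (j.+1 * M))%:E))%E).
    apply: (ge0_le_integral _ measurableT).
    - by move=> y _; rewrite lee_fin.
    - exact: mshift.
    - apply: measurable_funeM.
      exact: (mshift _ _ (measurable_regret_mean false _)).
    - by move=> y _; rewrite -EFinM lee_fin -mulrA.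
  rewrite (ge0_integralZl _ measurableT
    (mshift _ X (measurable_regret_mean false (j.+1 * M)))).
  - by rewrite integral_regret_mean -EFinM ltry.
  - by move=> y _; rewrite lee_fin.
  - by rewrite lee_fin mulr_ge0.
have int0 X : (0 <= \int[batch]_y (v i j.+1 (X + y))%:E)%E.
  by apply: integral_ge0 => y _; rewrite lee_fin.
pose w X := fine (\int[batch]_y (v i j.+1 (X + y))%:E)%E.
have wE X : (\int[batch]_y (v i j.+1 (X + y))%:E = (w X)%:E)%E.
  by rewrite fineK// ge0_fin_numE// int_lty.
have w0 X : 0 <= w X by exact: fine_ge0.
have mw : measurable_fun [set: measurableTypeR R] w.
  have mg : measurable_fun [set: measurableTypeR R * measurableTypeR R]
      (fun u : measurableTypeR R * measurableTypeR R =>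
         (v i j.+1 (u.1 + u.2))%:E).
    by apply/measurable_EFinP; apply: (measurableT_comp mv2);
      exact: measurable_funD.
  have g0 (u : measurableTypeR R * measurableTypeR R) :
      (0 <= (v i j.+1 (u.1 + u.2))%:E)%E by rewrite lee_fin.
  exact: (measurableT_comp (fine_measurable measurableT)
    (measurable_fun_fubini_tonelli_F (m2 := batch) _ mg g0)).
have vE X : v i j X = Num.min (M%:R * regret_mean false X (j * M) + v i.+1 j X)
    (M%:R * regret_mean true X (j * M) + w X) by exact: vlt.
split.
- rewrite (_ : v i j = fun X => Num.min
      (M%:R * regret_mean false X (j * M) + v i.+1 j X)
      (M%:R * regret_mean true X (j * M) + w X)); last first.
    by apply/funext => X; rewrite vE.
  apply: measurable_minr; apply: measurable_funD => //;
    by apply: measurable_funM => //; exact: measurable_regret_mean.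
- move=> X; rewrite vE le_min; apply/andP.
  by split; apply: addr_ge0 => //; apply: mulr_ge0.
- move=> X; rewrite vE ge_min; apply/orP; left.
  by rewrite -natr1 mulrDl mul1r addrC lerD2r.
- move=> X b; rewrite mulSn addnC optimal_cost_batch V1.
  (* Both regrets are martingales: averaging over the batch returns them to [j * M] observations,
     while the count of uses stays at [j.+1 * M]. *)
  have -> : (\int[batch]_y V (S * M) (i * M) (j.+1 * M) (X + y) true =
      ((i * M)%:R * regret_mean false X (j * M) +
       (j.+1 * M)%:R * regret_mean true X (j * M) + w X)%:E)%E.
    pose c a : R := (if a then j.+1 else i)%:R * M%:R.
    have cf0 a y : (0 <= (c a * regret_mean a (X + y) (j.+1 * M))%:E)%E.
      by rewrite lee_fin !mulr_ge0.
    have mcf a : measurable_fun [set: measurableTypeR R]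
        (fun y => (c a * regret_mean a (X + y) (j.+1 * M))%:E).
      apply: (mshift (fun x => c a * regret_mean a x (j.+1 * M))).
      by apply: measurable_funM => //; exact: measurable_regret_mean.
    have icf a : (\int[batch]_y (c a * regret_mean a (X + y) (j.+1 * M))%:E =
        (c a * regret_mean a X (j * M))%:E)%E.
      under eq_integral do rewrite EFinM.
      rewrite (ge0_integralZl _ measurableT
        (mshift _ X (measurable_regret_mean a (j.+1 * M)))).
      - by rewrite integral_regret_mean.
      - by move=> y _; rewrite lee_fin.
      - by rewrite lee_fin mulr_ge0.
    transitivity (\int[batch]_y
      ((c false * regret_mean false (X + y) (j.+1 * M))%:E +
       (c true * regret_mean true (X + y) (j.+1 * M))%:E +
       (v i j.+1 (X + y))%:E))%E.
      apply: eq_integral => y _; rewrite V2 posterior_costE -!EFinD /c.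
      by rewrite !natrM.
    rewrite (ge0_integralD _ measurableT); last 4 first.
    - by move=> y _; rewrite adde_ge0.
    - exact: emeasurable_funD.
    - by move=> y _; rewrite lee_fin.
    - exact: mshift.
    rewrite (ge0_integralD _ measurableT)//.
    by rewrite !icf wE -!EFinD /c !natrM.
  (* Each branch exceeds the current posterior cost by [M] times the regret of its action plus the
     future; the common part leaves the minimum. *)
  rewrite !posterior_costE -!EFinD -EFin_min vE; congr EFin.
  rewrite addr_minr !mulSn !natrD; congr Num.min; ring.
Qed.

End batches.

(** * Scaling *)

Section scaling.
Context {R : realType} (D C : R) (N M : nat) (lambda : R -> R).
Local Notation mu := (@lebesgue_measure R).
Hypotheses (D0 : 0 < D) (C0 : 0 < C) (N0 : (0 < N)%N) (M0 : (0 < M)%N).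
Hypotheses (mlambda : measurable_fun `[- C, C] lambda)
  (lambda0 : forall m, m \in `[- C, C] -> 0 <= lambda m).

Let sqN : R := Num.sqrt N%:R.
Let eps : R := M%:R / N%:R.
Let c : R := sqN * C.
Let rho (w : R) : R := sqN^-1 * lambda (sqN^-1 * w).

(** Extending by 0 lets all integrals in m range over the whole line, where the changes of variables
    are stated. *)
Definition prior_ext : R -> R := lambda \_ `[- C, C].

Lemma prior_extE m : m \in `[- C, C] -> prior_ext m = lambda m.
Proof. by move=> mC; rewrite /prior_ext patchE mem_setE mC. Qed.

Lemma prior_ext_out m : C < `|m| -> prior_ext m = 0.
Proof.
move=> mC; rewrite /prior_ext patchE mem_setE ifF//.
by apply/negbTE; rewrite in_itv/= -ler_norml -ltNge.
Qed.

Let in_supp m : (m \in `[- C, C]) = (`|m| <= C).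
Proof. by rewrite in_itv/= ler_norml. Qed.

Lemma prior_ext_ge0 m : 0 <= prior_ext m.
Proof.
have [mC|mC] := boolP (m \in `[- C, C]); first by rewrite prior_extE// lambda0.
by rewrite prior_ext_out// ltNge -in_supp.
Qed.

Lemma measurable_prior_ext : measurable_fun [set: measurableTypeR R] prior_ext.
Proof. exact: (measurable_restrictT _ _).1. Qed.

Lemma integral_prior_ext (f : R -> R) :
  (\int[mu]_(m in `[(- C)%R, C]) (f m * lambda m)%:E =
   \int[mu]_m (f m * prior_ext m)%:E)%E.
Proof.
rewrite integral_mkcond; apply: eq_integral => m _.
rewrite patchE mem_setE; case: ifPn => mC; first by rewrite prior_extE.
by rewrite prior_ext_out ?mulr0// ltNge -in_supp.
Qed.

Let sqN_gt0 : 0 < sqN.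
Proof. by rewrite sqrtr_gt0 ltr0n. Qed.

Let sqN_neq0 : sqN != 0.
Proof. by rewrite gt_eqF. Qed.

Let sqNV2 : sqN^-1 ^+ 2 = N%:R^-1.
Proof. by rewrite exprVn sqr_sqrtr. Qed.

(** An infinite [z] stays infinite under a positive factor, and [fine] sends it to 0 on both
    sides. *)
Let fineZl (k : R) (z : \bar R) : 0 < k -> fine (k%:E * z)%E = k * fine z.
Proof.
move=> k0; case: z => [r| |] //=.
  by rewrite gt0_muley ?lte_fin//= mulr0.
by rewrite gt0_muleNy ?lte_fin//= mulr0.
Qed.

Let regret_mean_scaled a X j :
  sqN * regret_mean D prior_ext a X (j * M) =
  fine (\int[mu]_w (regret a (sqN^-1 * w) *
    lratio D (sqN^-1 * w) X (j * M)%:R * prior_ext (sqN^-1 * w))%:E)%E.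
Proof.
have k0 : 0 < sqN^-1 by rewrite invr_gt0.
have mreg : measurable_fun [set: measurableTypeR R] (fun m : R =>
    (regret a m * lratio D m X (j * M)%:R * prior_ext m)%:E).
  apply: (measurable_regret_density D measurable_prior_ext a) => //;
  exact: measurable_cst.
have reg0 m := regret_density_ge0 D prior_ext_ge0 a m X (j * M)%:R.
have e := ge0_integral_affine 0 k0 mreg reg0.
rewrite /regret_mean /posterior_regret e (fineZl _ k0) mulrA mulfV// mul1r.
by congr fine; apply: eq_integral => w _; rewrite addr0.
Qed.

Let lratio_scaled w X j : lratio D (sqN^-1 * w) X (j * M)%:R =
  expR (D^-1 * (sqN^-1 * X * w - 2^-1 * (j%:R * eps) * w ^+ 2)).
Proof. by rewrite /lratio exprMn sqNV2 natrM /eps; congr expR; ring. Qed.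

(** In the substitution m = w / sqN the Jacobian cancels the factor [sqN] on the right; the factor
    [sqN^-1] of [rho] is the one left by the regret, linear in m. *)
Lemma g1_scaled X j : g1 D c rho (sqN^-1 * X) (j%:R * eps) =
  sqN * regret_mean D prior_ext false X (j * M).
Proof.
rewrite regret_mean_scaled /g1 /Rintegral integral_mkcond; congr fine.
apply: eq_integral => w _; rewrite patchE mem_setE in_itv/=.
case: ifPn => [/andP[w0 wc]|].
  have kw0 : 0 <= sqN^-1 * w by rewrite mulr_ge0// invr_ge0 ltW.
  have kwC : sqN^-1 * w \in `[- C, C].
    by rewrite in_supp ger0_norm// ler_pdivrMl.
  rewrite prior_extE// lratio_scaled /regret max_r//.
  by congr EFin; rewrite /rho; ring.
rewrite negb_and -!ltNge => /orP[w0|wc]; congr EFin; apply/esym.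
  rewrite /regret max_l ?mul0r//.
  by rewrite pmulr_rle0 ?invr_gt0// ltW.
rewrite prior_ext_out ?mulr0//.
by rewrite (lt_le_trans _ (ler_norm _))// ltr_pdivlMl.
Qed.

Lemma g2_scaled X j : g2 D c rho (sqN^-1 * X) (j%:R * eps) =
  sqN * regret_mean D prior_ext true X (j * M).
Proof.
rewrite regret_mean_scaled /g2 /Rintegral integral_mkcond; congr fine.
apply: eq_integral => w _; rewrite patchE mem_setE in_itv/=.
case: ifPn => [/andP[wc w0]|].
  have kw0 : sqN^-1 * w <= 0 by rewrite pmulr_rle0 ?invr_gt0.
  have kwC : sqN^-1 * w \in `[- C, C].
    by rewrite in_supp ler0_norm// -mulrN ler_pdivrMl// lerNl.
  rewrite prior_extE// lratio_scaled /regret max_r ?oppr_ge0// ler0_norm//.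
  by congr EFin; rewrite /rho; ring.
rewrite negb_and -!ltNge => /orP[wc|w0]; congr EFin; apply/esym.
  rewrite prior_ext_out ?mulr0//.
  rewrite -normrN (lt_le_trans _ (ler_norm _))// -mulrN ltr_pdivlMl//.
  by rewrite ltrNr.
rewrite /regret max_l ?mul0r//.
by rewrite oppr_le0 mulr_ge0// ?invr_ge0 ltW.
Qed.

(** Since [M = N * eps], the two standard deviations have ratio [sqN]. *)
Lemma normal_pdf_scaled y : normal_pdf 0 (Num.sqrt (M%:R * D)) (sqN * y) =
  sqN^-1 * normal_pdf 0 (Num.sqrt (eps * D)) y.
Proof.
have MR0 : 0 < M%:R :> R by rewrite ltr0n.
have NR0 : 0 < N%:R :> R by rewrite ltr0n.
have e0 : 0 < eps by rewrite divr_gt0.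
have MD0 : 0 < M%:R * D by rewrite mulr_gt0.
have eD0 : 0 < eps * D by rewrite mulr_gt0.
rewrite !normal_pdfE ?gt_eqF ?sqrtr_gt0// mulrA; congr (_ * _).
  rewrite /normal_peak -invfM; congr (_^-1).
  rewrite !sqr_sqrtr ?ltW// -sqrtrM ?ler0n//; congr Num.sqrt.
  by rewrite /eps; field; rewrite gt_eqF.
rewrite /normal_fun !sqr_sqrtr ?ltW// !subr0 exprMn sqr_sqrtr//; congr expR.
by rewrite /eps; field; rewrite !gt_eqF.
Qed.

Lemma conv_scaled (q u : R -> R) X :
  measurable_fun [set: measurableTypeR R] u -> (forall x, 0 <= u x) ->
  (forall x, u x = sqN * q (sqN^-1 * x)) ->
  sqN * Defs.conv q (gauss (eps * D) 0) (sqN^-1 * X) =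
  fine (\int[normal_prob 0 (Num.sqrt (M%:R * D))]_y (u (X + y))%:E)%E.
Proof.
move=> mu0 u0 uq.
have mshift : measurable_fun [set: measurableTypeR R] (fun y => (u (X + y))%:E).
  apply/measurable_EFinP; apply: (measurableT_comp mu0).
  exact: measurable_funD.
have shift0 y : (0 <= (u (X + y))%:E)%E by rewrite lee_fin.
rewrite (ge0_integral_normal_prob _ _ mshift shift0).
set F := (X in fine (integral _ _ X)).
have mF : measurable_fun [set: measurableTypeR R] F.
  apply: emeasurable_funM => //.
  by apply/measurable_EFinP; exact: measurable_normal_pdf.
have F0 y : (0 <= F y)%E by rewrite mule_ge0// lee_fin normal_pdf_ge0.
(* [conv] subtracts its variable whereas a batch adds its increment; the even Gaussian density
   allows a reflection before rescaling. *)
rewrite -(ge0_integral_oppr mF F0).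
have mFN : measurable_fun [set: measurableTypeR R] (fun y => F (- y)).
  exact: measurableT_comp.
have e := ge0_integral_affine 0 sqN_gt0 mFN (fun y => F0 (- y)).
apply: esym; apply: etrans (congr1 fine e) _.
apply: etrans (fineZl _ sqN_gt0) _; apply: (congr1 ( *%R sqN)).
apply: (congr1 fine).
apply: eq_integral => y _; rewrite addr0 /F -EFinM; congr EFin.
rewrite -mulrN normal_pdf_scaled uq /gauss.
have -> : sqN^-1 * (X + sqN * - y) = sqN^-1 * X - y by field.
have -> : normal_pdf 0 (Num.sqrt (eps * D)) (- y) =
    normal_pdf 0 (Num.sqrt (eps * D)) y.
  rewrite !normal_pdfE ?gt_eqF ?sqrtr_gt0 ?mulr_gt0 ?invr_gt0 ?ltr0n//.
  by rewrite /normal_fun !subr0 sqrrN.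
by field.
Qed.

End scaling.

Theorem theorem3p1 (R : realType) (D C : R) (N M : nat)
    (mu1 : probability (measurableTypeR R) R) (lambda : R -> R)
    (r r1 r2 : R -> R -> R -> R) :
  let eps : R := M%:R / N%:R in
  let c : R := Num.sqrt N%:R * C in
  let rho : R -> R := fun w =>
    (Num.sqrt N%:R)^-1 * lambda ((Num.sqrt N%:R)^-1 * w) in
  0 < D -> 0 < C -> (0 < N)%N -> (0 < M)%N -> (M %| N)%N ->
  mu1.-integrable [set: R] (fun x : R => x%:E) ->
  (\int[mu1]_x x%:E = 0)%E ->
  measurable_fun `[- C, C] lambda ->
  (forall m, m \in `[- C, C] -> 0 <= lambda m) ->
  (\int[lebesgue_measure]_(m in `[(- C)%R, C]) (lambda m)%:E = 1)%E ->
  0 < \int[lebesgue_measure]_(m in `[- C, 0]) (`|m| * lambda m) ->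
  0 < \int[lebesgue_measure]_(m in `[0, C]) (m * lambda m) ->
  dp_equation D eps (g1 D c rho) (g2 D c rho) r r1 r2 ->
  is_bayes_risk D N M mu1 C lambda (Num.sqrt N%:R * r 0 0 0).
Proof.
move=> eps c rho D0 C0 N0 M0 MN imu1 mean1 mlambda lambda0 lambda1 _ _ dp.
set sqN := Num.sqrt N%:R.
pose lam := prior_ext C lambda.
have [K NE] : exists K, N = (K * M)%N by exists (N %/ M)%N; rewrite divnK.
have mlam : measurable_fun [set: measurableTypeR R] lam.
  exact: measurable_prior_ext.
have lam0 m : 0 <= lam m by exact: prior_ext_ge0.
have lamC m : C < `|m| -> lam m = 0 by exact: prior_ext_out.
have lam_lty : (\int[lebesgue_measure]_m (lam m)%:E < +oo)%E.
  have := integral_prior_ext C lambda (cst 1).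
  under eq_integral do rewrite mul1r.
  under [X in _ = X -> _]eq_integral do rewrite mul1r.
  by rewrite lambda1 => <-; rewrite ltry.
have sqN0 : sqN != 0 by rewrite gt_eqF// sqrtr_gt0 ltr0n.
(* One [sqN] is the factor of the risk, the other comes from [g1_scaled] and [g2_scaled]; together
   with [eps] they make the [M] uses of a batch. *)
have sqNeps : sqN * eps * sqN = M%:R.
  rewrite mulrAC -expr2 sqr_sqrtr// /eps mulrC divfK//.
  by rewrite pnatr_eq0 -lt0n.
have rescale z : sqN * (eps * (sqN * z)) = M%:R * z.
  by rewrite -sqNeps !mulrA.
have epsS (n : nat) : n.+1%:R * eps = n%:R * eps + eps.
  by rewrite -natr1 mulrDl mul1r.
(* The solution in unscaled variables, indexed by numbers of batches; the positive factor [sqN]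
   passes through the minimum. *)
pose v (i j : nat) (X : R) : R :=
  sqN * r (i%:R * eps) (sqN^-1 * X) (j%:R * eps).
have epsE : eps = K%:R^-1.
  by rewrite /eps NE natrM invfM mulrCA divff ?mulr1// pnatr_eq0 -lt0n.
have K0 : (0 < K)%N by move: N0; rewrite NE; case: (K).
have KR0 : 0 < K%:R :> R by rewrite ltr0n.
have sumE (i j : nat) : i%:R * eps + j%:R * eps = (i + j)%:R / K%:R.
  by rewrite epsE -mulrDl natrD.
have vK i j X : (i + j = K)%N -> v i j X = 0.
  move=> ijK; have ij1 : i%:R * eps + j%:R * eps = 1.
    by rewrite sumE ijK divff// gt_eqF.
  have [|rE /(_ ij1)[r1E r2E] _] := dp i j (sqN^-1 * X); first by rewrite ij1.
  by rewrite /v rE r1E r2E minxx mulr0.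
have vlt i j X : (i + j < K)%N ->
    measurable_fun [set: measurableTypeR R] (v i j.+1) ->
    (forall x, 0 <= v i j.+1 x) -> v i j X =
    Num.min (M%:R * regret_mean D lam false X (j * M) + v i.+1 j X)
      (M%:R * regret_mean D lam true X (j * M) +
       fine (\int[normal_prob 0 (Num.sqrt (M%:R * D))]_y
         (v i j.+1 (X + y))%:E)%E).
  move=> ijK mv v0.
  have ij1 : i%:R * eps + j%:R * eps < 1.
    by rewrite sumE ltr_pdivrMr// mul1r ltr_nat.
  have [|rE _ /(_ ij1)[r1E r2E]] := dp i j (sqN^-1 * X); first exact: ltW.
  rewrite /v rE minr_pMr ?ltW ?sqrtr_gt0 ?ltr0n//; congr Num.min.
    rewrite r1E g1_scaled// -/lam -/sqN mulrDr rescale.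
    by rewrite /v epsS.
  rewrite r2E g2_scaled// -/lam -/sqN mulrDr rescale -epsS; congr (_ + _).
  exact: (conv_scaled D0 N0 M0 (q := fun x => r (i%:R * eps) x (j.+1%:R * eps))
    X mv v0 (fun=> erefl)).
have [_ _ _ V0] := optimal_cost_dp D0 M0 mlam lam0 (ltW C0) lamC lam_lty vK vlt
  (erefl : 0 + 0 + K = K)%N.
(* At the origin no action has been used, so the posterior cost vanishes and only [v] remains. *)
have v00 : optimal_cost D M lam N 0 0 0 false =
    (Num.sqrt N%:R * r 0 0 0)%:E.
  have := V0 0 false; rewrite !mul0n -NE => ->.
  by rewrite /posterior_cost !mul0e !add0e /v mulr0 mul0r.
have bayesE sigma : (bayes_loss D N M mu1 C lambda sigma)%:E =
    (\int[law M sigma (income D mu1 0) N]_h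
      of_history (optimal_cost D M lam 0) h)%E.
  have [_ e] := integral_posterior_cost mlam lam0 M sigma D0 imu1 mean1 N.
  have := integral_posterior_cost_lty mlam lam0 M sigma D0 imu1 mean1
    (ltW C0) lamC lam_lty N.
  rewrite /bayes_loss /Rintegral integral_prior_ext -/lam -e => lty.
  by rewrite fineK// ge0_fin_numE//; apply: integral_ge0 => h _;
    exact: posterior_cost_ge0.
split.
  exists (optimal_strategy D M mlam lam0 N); apply: EFin_inj.
  rewrite bayesE -v00.
  by rewrite (optimal_cost_integral D M mlam lam0 mu1 (leqnn N)) subnn.
move=> sigma; rewrite -lee_fin bayesE -v00.
have := optimal_cost_le_integral D M mlam lam0 mu1 sigma (leqnn N).
by rewrite subnn.
Qed.
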